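(* Let $r(x)$ be a meromorphic function on $\mathbb C$, not identically zero, all of whose zeros $x_k$ and all of whose poles $y_\ell$ are simple, and let $q(x)=1/r(x)$. Consider the system $$\frac{dW(x,\rho)}{dx}=\rho\begin{pmatrix}0& r(x)^{-2}\\ r(x)^2&0\end{pmatrix}W(x,\rho).$$ Then for every $\rho\in\mathbb C$ every zero and every pole of $r$ is a strong regular point of this system (i.e. the fundamental solution is global strong regular, hence meromorphic in $x$ on $\mathbb C$) if and only if $$r''(x_k)=0\ \text{for every zero } x_k \text{ of } r,\qquad q''(y_\ell)=0\ \text{for every zero } y_\ell \text{ of } q.$$
   Context: For a system $\frac{dW}{dx}=A(x)W$ with $A$ holomorphic and single-valued in a punctured disc around $x_0$, every fundamental (invertible matrix) solution has the form $W(x)=S(x)(x-x_0)^{\Phi}$ with $S$ holomorphic and single-valued in the punctured disc and $\Phi$ a constant matrix. The point $x_0$ is called strong regular for the system if a fundamental solution $W$ is single-valued in the punctured disc and has at most a pole at $x_0$, i.e. $W(x)=\sum_{k\ge m}b_k(x-x_0)^k$ for some $m\in\mathbb Z$. A fundamental solution is called global strong regular if it is strong regular at every singular point of $A$. *)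

(* Defs.v *)
(* MathComp-Analysis over C := Cx R (complex numbers of a realType R).
   Complex differentiability = derivability along 1 with scalars in Cx R. *)
From HB Require Import structures.
From mathcomp Require Import all_boot all_order all_algebra.
From mathcomp Require Import all_classical all_reals all_analysis.
From mathcomp Require Import complex.
Set Implicit Arguments. Unset Strict Implicit. Unset Printing Implicit Defensive.
Import Order.TTheory GRing.Theory Num.Theory ComplexField.
Import numFieldNormedType.Exports.
Local Open Scope classical_set_scope.
Local Open Scope ring_scope.

(* the complex numbers R[i], seen as a numFieldType (so that MathComp-Analysis
   equips it with its normed/topological structure as a field over itself) *)
Definition Cx (R : realType) : numFieldType := R[i].

Definition holo_disc (R : realType) (V : normedModType (Cx R)) (f : Cx R -> V)
  (a e : Cx R) : Prop :=
  forall x : Cx R, `|x - a| < e -> derivable f x 1.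

Definition pole_of_order (R : realType) (r : Cx R -> Cx R) (p : Cx R) (m : nat)
  : Prop :=
  (0 < m)%N /\
  exists (h : Cx R -> Cx R) (e : Cx R), 0 < e /\ holo_disc h p e /\ h p != 0 /\
    forall x : Cx R, 0 < `|x - p| < e -> r x = h x / (x - p) ^+ m.

(* r : C -> C is meromorphic on C with pole set P: P has no accumulation point
   in C, r is holomorphic outside P, and r has a (genuine) pole at each point of P.
   (The values of r on P are irrelevant.) *)
Definition meromorphic (R : realType) (r : Cx R -> Cx R) (P : set (Cx R)) : Prop :=
  [/\ (forall z : Cx R, exists2 e : Cx R, 0 < e &
          forall y, `|y - z| < e -> P y -> y = z),
      (forall z : Cx R, ~ P z -> derivable r z 1) &
      (forall p : Cx R, P p -> exists m : nat, pole_of_order r p m)].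

Definition zero_of (R : realType) (r : Cx R -> Cx R) (P : set (Cx R)) (z : Cx R)
  : Prop := ~ P z /\ r z = 0.

(* q = 1/r, extended by its (removable) value 0 at the poles of r *)
Definition recip_ext (R : realType) (r : Cx R -> Cx R) (P : set (Cx R)) :
  Cx R -> Cx R :=
  fun x => if `[< P x >] then 0 else (r x)^-1.

Definition sysA (R : realType) (r : Cx R -> Cx R) (rho : Cx R) (x : Cx R)
  : 'M[(Cx R)]_2 :=
  rho *: \matrix_(i < 2, j < 2)
    (if (i : nat) == j then 0
     else if (i : nat) == 0%N then (r x ^+ 2)^-1 else r x ^+ 2).

(* x0 is a strong regular point of dW/dx = A(x) W: on some punctured disc
   0 < |x - x0| < e there is a (single-valued) fundamental solution W
   (W' = A W, W(x) invertible) having at most a pole at x0, i.e.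
   W(x) = (x - x0)^m H(x) with m : int and H holomorphic on the full disc
   (equivalently W(x) = sum_{k >= m} b_k (x - x0)^k). *)
Definition strong_regular (R : realType) (A : Cx R -> 'M[(Cx R)]_2) (x0 : Cx R)
  : Prop :=
  exists (e : Cx R) (W : Cx R -> 'M[(Cx R)]_2), 0 < e /\
    (forall x : Cx R, 0 < `|x - x0| < e ->
        is_derive x 1 W (A x *m W x) /\ W x \in unitmx) /\
    exists (m : int) (H : Cx R -> 'M[(Cx R)]_2),
      holo_disc H x0 e /\
      forall x : Cx R, 0 < `|x - x0| < e -> W x = (x - x0) ^ m *: H x.

(* Main.v *)
Require Import Defs.
From HB Require Import structures.
From mathcomp Require Import all_boot all_order all_algebra.
From mathcomp Require Import all_classical all_reals all_analysis.
From mathcomp Require Import complex.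
From mathcomp Require Import ring lra zify.
Import Order.TTheory GRing.Theory Num.Theory ComplexField.
Import numFieldNormedType.Exports.
Set Implicit Arguments. Unset Strict Implicit. Unset Printing Implicit Defensive.
Local Open Scope classical_set_scope.
Local Open Scope ring_scope.

(** A function that is merely complex differentiable on a disc has a convergent
    power series: Goursat's bisection argument makes its integral over rectangles
    vanish, and expanding Cauchy's kernel over a square leaves remainders with a
    geometric bound.  Near a simple zero of r one has r^2 = z^2 G = z^2 / K with G
    holomorphic, and U = z w_1, V = w_2 satisfy z U' = U + rho K V and
    z V' = rho z^2 G U.  In the coefficient recurrences the index 1 is resonant:
    u_1 is free, and the equation reduces to rho k_1 v_0 = 0, where k_1 = 0 iff
    r'' vanishes at the zero.  If k_1 = 0, choosing v_0 and u_1 freely gives two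
    independent solutions, convergent by a majorant argument.  If k_1 <> 0 and
    rho <> 0, every solution with at most a pole is determined by its single
    coefficient u_1, so no two of them form an invertible matrix.  Poles of r
    reduce to zeros of 1 / r by exchanging the two coordinates. *)

(** At z = 0 the exponents of the system in (U, V) are 1 and 0. They differ by an integer, so in
    general one solution carries a logarithm; its coefficient is a multiple of rho k_1, which is why
    a single number decides the matter. With r = z g and g = phi_1 + phi_2 z + ..., the series of K
    = 1 / g^2 has k_1 = -2 phi_2 / phi_1^3: this is how r'' enters although the system contains only
    r^2. For the converse the order of the pole is not known in advance, so the recurrences are set
    up for z^(N+1) w_1 and z^N w_2 with N arbitrary, and the conclusion is drawn from the single
    value rho = 1. Squares rather than circles serve as contours because each edge is then a plain
    real integral. The value 2 pi i is never computed: the contour integral of 1/z is only shown to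
    be nonzero, and it normalises the Taylor coefficients. *)

Section ComplexNorm.
Variable R : realType.
Local Notation C := (Cx R).
Implicit Types (x y z : C) (a b : R).

(** The norm [|z|] is itself an element of C. A real-valued modulus lets all estimates be carried
    out in the ordered field R. *)
Definition cnorm (z : C) : R := Normc.normc z.
Definition cof (a : R) : C := a%:C%C.
Definition mkc (a b : R) : C := (a +i* b)%C.
Definition cRe (z : C) : R := complex.Re z.
Definition cIm (z : C) : R := complex.Im z.
Definition ci : C := mkc 0 1.

Lemma normE z : `|z| = cof (cnorm z).
Proof. by case: z => a b; rewrite /cnorm /cof /=. Qed.

Lemma cnorm0 : cnorm 0 = 0. Proof. exact: Normc.normc0. Qed.
Lemma cnorm1 : cnorm 1 = 1. Proof. exact: Normc.normc1. Qed.
Lemma cnorm_ge0 z : 0 <= cnorm z.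
Proof. by case: z => a b; rewrite /cnorm /= sqrtr_ge0. Qed.
Lemma cnorm_eq0 z : (cnorm z == 0) = (z == 0).
Proof.
apply/eqP/eqP => [|->]; last exact: cnorm0.
exact: Normc.eq0_normc.
Qed.
Lemma cnorm_gt0 z : (0 < cnorm z) = (z != 0).
Proof. by rewrite lt_def cnorm_ge0 andbT cnorm_eq0. Qed.
Lemma cnormM x y : cnorm (x * y) = cnorm x * cnorm y.
Proof. exact: Normc.normcM. Qed.
Lemma cnormV x : cnorm x^-1 = (cnorm x)^-1.
Proof. exact: Normc.normcV. Qed.
Lemma cnormD x y : cnorm (x + y) <= cnorm x + cnorm y.
Proof. exact: le_normcD. Qed.
Lemma cnormN x : cnorm (- x) = cnorm x.
Proof. exact: normcN. Qed.
Lemma cnormB x y : cnorm (x - y) <= cnorm x + cnorm y.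
Proof. by rewrite -(cnormN y) cnormD. Qed.
Lemma cnorm_distC x y : cnorm (x - y) = cnorm (y - x).
Proof. by rewrite -cnormN opprB. Qed.
Lemma cnorm_subr x y : cnorm x - cnorm y <= cnorm (x - y).
Proof. by rewrite lerBlDr (le_trans _ (cnormD _ _))// subrK. Qed.
Lemma cnormX x n : cnorm (x ^+ n) = cnorm x ^+ n.
Proof.
by elim: n => [|n IH]; rewrite ?expr0 ?cnorm1// !exprS cnormM IH.
Qed.
Lemma cnorm_sum (F : nat -> C) n :
  cnorm (\sum_(i < n) F i) <= \sum_(i < n) cnorm (F i).
Proof.
elim: n => [|n IH]; first by rewrite !big_ord0 cnorm0.
by rewrite !big_ord_recr/= (le_trans (cnormD _ _))// lerD2r.
Qed.
Lemma cnorm_cof a : cnorm (cof a) = `|a|.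
Proof. by rewrite /cnorm /= expr0n/= addr0 sqrtr_sqr. Qed.
Lemma cnorm_nat n : cnorm n%:R = n%:R.
Proof.
have -> : (n%:R : C) = cof n%:R by rewrite /cof rmorph_nat.
by rewrite cnorm_cof ger0_norm.
Qed.

Lemma sqr_cnorm z : cnorm z ^+ 2 = cRe z ^+ 2 + cIm z ^+ 2.
Proof.
by case: z => a b; rewrite /cnorm /= sqr_sqrtr// addr_ge0// sqr_ge0.
Qed.
Lemma cRe_le z : `|cRe z| <= cnorm z.
Proof.
rewrite -(ler_pXn2r (_ : (0 < 2)%N)) ?nnegrE ?cnorm_ge0//.
by rewrite sqr_cnorm real_normK ?num_real// lerDl sqr_ge0.
Qed.
Lemma cIm_le z : `|cIm z| <= cnorm z.
Proof.
rewrite -(ler_pXn2r (_ : (0 < 2)%N)) ?nnegrE ?cnorm_ge0//.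
by rewrite sqr_cnorm real_normK ?num_real// lerDr sqr_ge0.
Qed.
Lemma cnorm_leReIm z : cnorm z <= `|cRe z| + `|cIm z|.
Proof.
rewrite -(ler_pXn2r (_ : (0 < 2)%N)) ?nnegrE ?cnorm_ge0 ?addr_ge0//.
rewrite sqr_cnorm sqrrD !real_normK ?num_real// lerD2r lerDl.
by rewrite mulrn_wge0// mulr_ge0.
Qed.

Lemma mkcE z : mkc (cRe z) (cIm z) = z. Proof. by case: z. Qed.
Lemma cReD x y : cRe (x + y) = cRe x + cRe y. Proof. by case: x; case: y. Qed.
Lemma cImD x y : cIm (x + y) = cIm x + cIm y. Proof. by case: x; case: y. Qed.
Lemma cReN x : cRe (- x) = - cRe x. Proof. by case: x. Qed.
Lemma cImN x : cIm (- x) = - cIm x. Proof. by case: x. Qed.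
Lemma cReM x y : cRe (x * y) = cRe x * cRe y - cIm x * cIm y.
Proof. by case: x; case: y. Qed.
Lemma cImM x y : cIm (x * y) = cRe x * cIm y + cIm x * cRe y.
Proof. by case: x; case: y. Qed.
Lemma cofD a b : cof (a + b) = cof a + cof b. Proof. exact: rmorphD. Qed.
Lemma c_eqP x y : cRe x = cRe y -> cIm x = cIm y -> x = y.
Proof. by case: x y => a b [c d] /= -> ->. Qed.

Lemma cof_gt0 a : (0 < cof a) = (0 < a).
Proof. exact: (ltcR 0 a). Qed.
Lemma lt_cof a b : (cof a < cof b) = (a < b). Proof. exact: ltcR. Qed.
Lemma le_cof a b : (cof a <= cof b) = (a <= b). Proof. exact: lecR. Qed.
(** In the partial order of C, positivity forces a zero imaginary part. The complex radii of the
    definitions are thus turned into real ones. *)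
Lemma gt0_cof (e : C) : 0 < e -> exists2 a, 0 < a & e = cof a.
Proof.
case: e => a b; rewrite ltcE/= => /andP[/eqP -> a0].
by exists a.
Qed.

End ComplexNorm.

(** * Complex derivatives and continuity as epsilon-delta estimates *)

Section ComplexDerivative.
Variable R : realType.
Local Notation C := (Cx R).
Implicit Types (f g : C -> C) (x l : C).

(** The remainder form of differentiability needs neither a quotient nor the exclusion of h = 0, and
    it is the shape used in Goursat's estimate. *)
Definition cderiv f x l := forall e : R, 0 < e -> exists2 d : R, 0 < d &
  forall h : C, cnorm h < d -> cnorm (f (x + h) - f x - l * h) <= e * cnorm h.

Lemma cderivP f x l : is_derive x (1 : C) f l <-> cderiv f x l.
Proof.
have key : ((fun h : C => h^-1 *: ((f \o shift x) (h *: (1:C)) - f x)) @ 0^' --> l)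
   <-> cderiv f x l.
  have E (h : C) : h != 0 -> f (x + h) - f x - l * h =
      - ((l - h^-1 *: ((f \o shift x) (h *: (1:C)) - f x)) * h).
    move=> h0; rewrite /= [h *: 1]mulr1 (addrC h) /GRing.scale/=; field.
    exact: h0.
  apply: (iff_trans (cvgrPdist_le _ _)); split=> H e e0.
    have := H (cof e); rewrite cof_gt0 => /(_ e0) [d /= d0 Hd].
    have [d' d'0 dd'] := gt0_cof d0; exists d' => // h hd.
    have [->|h0] := eqVneq h 0.
      by rewrite addr0 mulr0 subrr subr0 cnorm0 mulr0.
    rewrite E// cnormN cnormM ler_pM2r ?cnorm_gt0//.
    have := Hd h; rewrite /= sub0r normrN normE dd' lt_cof => /(_ hd h0).
    by rewrite normE le_cof.
  have [e' e'0 ee'] := gt0_cof e0.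
  have [d d0 Hd] := H _ e'0.
  exists (cof d); rewrite /= ?cof_gt0// => h /=.
  rewrite sub0r normrN normE lt_cof => hd h0.
  rewrite normE ee' le_cof -(ler_pM2r (_ : 0 < cnorm h)) ?cnorm_gt0//.
  by rewrite -cnormM -cnormN -E// Hd.
split=> [[df dl]|/key H].
  by apply/key; rewrite -dl; exact: df.
apply: DeriveDef; first by apply/cvg_ex; exists l.
exact: cvg_lim H.
Qed.

Lemma derivable_cderiv f x : derivable f x 1 -> cderiv f x (derive1 f x).
Proof. by move=> df; apply/cderivP; rewrite derive1E; exact: derivableP. Qed.

Lemma cderiv_derivable f x l : cderiv f x l -> derivable f x 1.
Proof. by move/cderivP => []. Qed.

Lemma cderiv_derive1 f x l : cderiv f x l -> derive1 f x = l.
Proof. by move/cderivP => [_ <-]; rewrite derive1E. Qed.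

Lemma cderiv_unique f x l l' : cderiv f x l -> cderiv f x l' -> l = l'.
Proof. by move=> /cderiv_derive1 <- /cderiv_derive1. Qed.

Lemma cderiv_near f g x l (d : R) : 0 < d ->
  (forall y, cnorm (y - x) < d -> f y = g y) -> cderiv f x l -> cderiv g x l.
Proof.
move=> d0 fg df e e0; have [d' d'0 H] := df e e0.
exists (Num.min d d'); first by rewrite lt_min d0.
move=> h; rewrite lt_min => /andP[hd hd']; rewrite -!fg; first exact: H.
  by rewrite subrr cnorm0.
by rewrite addrAC subrr add0r.
Qed.

Lemma cderivD f g x l m : cderiv f x l -> cderiv g x m ->
  cderiv (fun z => f z + g z) x (l + m).
Proof. by move=> /cderivP ? /cderivP ?; apply/cderivP; exact: is_deriveD. Qed.

Lemma cderivB f g x l m : cderiv f x l -> cderiv g x m ->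
  cderiv (fun z => f z - g z) x (l - m).
Proof. by move=> /cderivP ? /cderivP ?; apply/cderivP; exact: is_deriveB. Qed.

Lemma cderivM f g x l m : cderiv f x l -> cderiv g x m ->
  cderiv (fun z => f z * g z) x (l * g x + f x * m).
Proof.
move=> /cderivP ? /cderivP ?; apply/cderivP.
have := @is_deriveM _ _ f g x 1 l m _ _; rewrite addrC /GRing.scale/= (mulrC l).
exact.
Qed.

Lemma cderiv_cst (c x : C) : cderiv (fun=> c) x 0.
Proof. by apply/cderivP; exact: is_derive_cst. Qed.

Lemma cderiv_id x : cderiv id x 1.
Proof. by apply/cderivP; exact: is_derive_id. Qed.

Lemma cderivZ (c : C) f x l : cderiv f x l -> cderiv (fun z => c * f z) x (c * l).
Proof. by move=> /(cderivM (cderiv_cst c x)); rewrite mul0r add0r. Qed.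

Lemma cderivX n x : cderiv (fun z => z ^+ n) x (n%:R * x ^+ n.-1).
Proof.
elim: n => [|n IH].
  rewrite mul0r; apply: cderiv_near ltr01 _ (cderiv_cst 1 x) => y _.
  by rewrite expr0.
have := cderivM (cderiv_id x) IH.
have -> : 1 * x ^+ n + x * (n%:R * x ^+ n.-1) = n.+1%:R * x ^+ n.+1.-1.
  case: n {IH} => [|n]; first by rewrite !expr0 mul0r mulr0 addr0.
  by rewrite /= !exprS -(natr1 n.+1); ring.
by apply: cderiv_near ltr01 _ => y _; rewrite exprS.
Qed.

Lemma cderivV f x l : f x != 0 -> cderiv f x l ->
  cderiv (fun z => (f z)^-1) x (- l / f x ^+ 2).
Proof.
move=> fx0 /cderivP [df dl]; apply/cderivP; apply: DeriveDef.
  exact: derivableV.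
by rewrite deriveV// dl /GRing.scale/= !mulNr mulrC.
Qed.

Lemma cderiv_shift f (c x l : C) :
  cderiv f (c + x) l -> cderiv (fun z => f (c + z)) x l.
Proof. by move=> df e e0; have [d d0 H] := df e e0; exists d => // h /H; rewrite addrA. Qed.

Definition ccont f x := forall e : R, 0 < e -> exists2 d : R, 0 < d &
  forall h : C, cnorm h < d -> cnorm (f (x + h) - f x) <= e.

Lemma cderiv_cont f x l : cderiv f x l -> ccont f x.
Proof.
move=> df e e0; have [d d0 H] := df 1 ltr01.
have L0 : 0 < 1 + cnorm l by rewrite ltr_wpDr// cnorm_ge0.
exists (Num.min d (e / (1 + cnorm l))).
  by rewrite lt_min d0 divr_gt0.
move=> h; rewrite lt_min => /andP[/H hd he].
rewrite -(subrK (l * h) (f (x + h) - f x)).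
rewrite (le_trans (cnormD _ _))//.
move: he; rewrite ltr_pdivlMr// => /ltW; apply: le_trans.
by rewrite mulrDr mulr1 cnormM (mulrC (cnorm h)) lerD// (le_trans hd)// mul1r.
Qed.

End ComplexDerivative.

(** * Cauchy's theorem *)

Section RealIntegral.
Variable R : realType.
Implicit Types (a b m : R) (g : R -> R).
Local Notation mu := (@lebesgue_measure R).

Definition rint a b g : R := \int[mu]_(t in `[a, b]) g t.

Lemma rint_integrable a b g : {in `[a, b], continuous g} ->
  mu.-integrable `[a, b] (EFin \o g).
Proof.
move=> gc; apply: continuous_compact_integrable; first exact: segment_compact.
apply: continuous_in_subspaceT => t; rewrite inE => tab; exact: gc.
Qed.

Lemma rint_split a m b g : a <= m <= b -> {in `[a, b], continuous g} ->
  rint a b g = rint a m g + rint m b g.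
Proof.
move=> /andP[am mb] gc; have gi := rint_integrable gc.
have := @Rintegral_itvB R g (BLeft a) (BRight b) m gi.
rewrite !bnd_simp => /(_ am mb) /eqP; rewrite subr_eq => /eqP E.
rewrite /rint E addrC; congr (_ + _); apply: Rintegral_itv_obnd_cbnd.
apply: integrableS gi => //; apply: subset_itvr => //.
Qed.

Lemma rintD a b g h : {in `[a, b], continuous g} -> {in `[a, b], continuous h} ->
  rint a b (fun t => g t + h t) = rint a b g + rint a b h.
Proof. by move=> /rint_integrable gi /rint_integrable hi; exact: RintegralD. Qed.

Lemma rintB a b g h : {in `[a, b], continuous g} -> {in `[a, b], continuous h} ->
  rint a b (fun t => g t - h t) = rint a b g - rint a b h.
Proof. by move=> /rint_integrable gi /rint_integrable hi; exact: RintegralB. Qed.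

Lemma rintZ a b k g : {in `[a, b], continuous g} ->
  rint a b (fun t => k * g t) = k * rint a b g.
Proof. by move=> /rint_integrable gi; exact: RintegralZl. Qed.

Lemma rint_cst a b k : a <= b -> rint a b (fun=> k) = k * (b - a).
Proof.
move=> ab; rewrite /rint Rintegral_cst//; congr (_ * _).
apply: (etrans (congr1 fine (lebesgue_measure_itv `[a, b]))) => /=.
rewrite lte_fin.
case: ltP => [_|ba]; first by rewrite -EFinB.
by have -> : b = a by [apply/eqP; rewrite eq_le ab ba]; rewrite subrr.
Qed.

Lemma rint_le a b g h : {in `[a, b], continuous g} -> {in `[a, b], continuous h} ->
  (forall t, a <= t <= b -> g t <= h t) -> rint a b g <= rint a b h.
Proof.
move=> /rint_integrable gi /rint_integrable hi gh; exact: le_Rintegral.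
Qed.

Lemma cst_continuous_in a b k : {in `[a, b], continuous (fun _ : R => k : R)}.
Proof. by move=> t _; exact: cvg_cst. Qed.

Lemma rint_norm a b g M : a <= b -> {in `[a, b], continuous g} ->
  (forall t, a <= t <= b -> `|g t| <= M) -> `|rint a b g| <= M * (b - a).
Proof.
move=> ab gc gM; rewrite ler_norml -mulNr -!rint_cst//; apply/andP; split.
  apply: rint_le => //; first exact: cst_continuous_in.
  by move=> t /gM; rewrite ler_norml => /andP[].
apply: rint_le => //; first exact: cst_continuous_in.
by move=> t /gM; rewrite ler_norml => /andP[].
Qed.

Lemma rint_FTC a b g (G : R -> R) : a <= b -> {in `[a, b], continuous g} ->
  (forall t, a <= t <= b -> is_derive t 1 G (g t)) -> rint a b g = G b - G a.
Proof.
rewrite le_eqVlt => /predU1P[->|ab] gc dG.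
  rewrite subrr /rint set_itv1; exact: Rintegral_set1.
have Gc t : a <= t <= b -> {for t, continuous G}.
  move=> /dG [d _]; exact/differentiable_continuous/derivable1_diffP.
rewrite /rint /Rintegral (@continuous_FTC2 _ g G)//.
- apply: continuous_in_subspaceT => t; rewrite inE => tab; exact: gc.
- split; last 2 first.
  + by apply: cvg_at_right_filter; apply: Gc; rewrite lexx ltW.
  + by apply: cvg_at_left_filter; apply: Gc; rewrite lexx ltW.
  move=> t; rewrite in_itv/= => /andP[t1 t2].
  by case: (dG t _); rewrite ?(ltW t1) ?(ltW t2).
- move=> t; rewrite in_itv/= => /andP[t1 t2].
  by rewrite derive1E; case: (dG t _); rewrite ?(ltW t1) ?(ltW t2).
Qed.

End RealIntegral.

(** * Complex-valued integrals over a real interval *)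

Section CurveIntegral.
Variable R : realType.
Local Notation C := (Cx R).
Implicit Types (a b m t : R) (h : R -> C).

Definition rccont h t := forall e : R, 0 < e -> exists2 d : R, 0 < d &
  forall s, `|s| < d -> cnorm (h (t + s) - h t) <= e.

Definition rcderiv h t (l : C) := forall e : R, 0 < e -> exists2 d : R, 0 < d &
  forall s, `|s| < d -> cnorm (h (t + s) - h t - l * cof s) <= e * `|s|.

Definition cint a b h : C :=
  mkc (rint a b (fun t => cRe (h t))) (rint a b (fun t => cIm (h t))).

Definition cts_on a b h := forall t, a <= t <= b -> rccont h t.

Let cts_proj (p : C -> R) a b h : (forall x y, p (x - y) = p x - p y) ->
  (forall x, `|p x| <= cnorm x) ->
  cts_on a b h -> {in `[a, b], continuous (fun t => p (h t))}.
Proof.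
move=> pB ple hc t; rewrite in_itv/= => /hc {}hc.
apply/cvgrPdist_le => /= e e0; have [d d0 H] := hc _ e0.
exists d => //= s; rewrite /= distrC => sd.
rewrite -pB -normrN -[- p _]addr0; apply: le_trans (H _ sd).
rewrite subrKC addr0 normrN; apply: le_trans (ple _) _.
by rewrite cnorm_distC.
Qed.

Let cReB (x y : C) : cRe (x - y) = cRe x - cRe y.
Proof. by rewrite cReD cReN. Qed.
Let cImB (x y : C) : cIm (x - y) = cIm x - cIm y.
Proof. by rewrite cImD cImN. Qed.

Lemma cts_Re a b h : cts_on a b h -> {in `[a, b], continuous (fun t => cRe (h t))}.
Proof. by apply: cts_proj => *; [exact: cReB | exact: cRe_le]. Qed.

Lemma cts_Im a b h : cts_on a b h -> {in `[a, b], continuous (fun t => cIm (h t))}.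
Proof. by apply: cts_proj => *; [exact: cImB | exact: cIm_le]. Qed.

Lemma cint_split a m b h : a <= m <= b -> cts_on a b h ->
  cint a b h = cint a m h + cint m b h.
Proof.
move=> amb hc; apply: c_eqP; rewrite ?cReD ?cImD /=; apply: rint_split => //.
  exact: cts_Re.
exact: cts_Im.
Qed.

Lemma cintB a b h k : cts_on a b h -> cts_on a b k ->
  cint a b (fun t => h t - k t) = cint a b h - cint a b k.
Proof.
move=> hc kc; apply: c_eqP; rewrite ?cReB ?cImB /= -rintB; do ?[exact: cts_Re|exact: cts_Im];
  by congr rint; apply/funext => t; rewrite ?cReB ?cImB.
Qed.

Lemma cintD a b h k : cts_on a b h -> cts_on a b k ->
  cint a b (fun t => h t + k t) = cint a b h + cint a b k.
Proof.
move=> hc kc; apply: c_eqP; rewrite ?cReD ?cImD /= -rintD; do ?[exact: cts_Re|exact: cts_Im];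
  by congr rint; apply/funext => t; rewrite ?cReD ?cImD.
Qed.

Lemma cintZ a b (c : C) h : cts_on a b h ->
  cint a b (fun t => c * h t) = c * cint a b h.
Proof.
move=> hc; have /= rc := cts_Re hc; have /= ic := cts_Im hc.
have mulc (k : R) (g : R -> R) : {in `[a, b], continuous g} ->
    {in `[a, b], continuous (fun t => k * g t)}.
  by move=> gc t tab; apply: cvgM; [exact: cvg_cst|exact: gc].
apply: c_eqP; rewrite ?cReM ?cImM /=.
  rewrite -!rintZ// -rintB; try exact: mulc.
  by congr rint; apply/funext => t; rewrite cReM.
rewrite -!rintZ// -rintD; try exact: mulc.
by congr rint; apply/funext => t; rewrite cImM.
Qed.

(** Real and imaginary parts are bounded separately, which costs the factor 2; no later estimate
    needs the sharp constant. *)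
Lemma cint_norm a b h M : a <= b -> cts_on a b h ->
  (forall t, a <= t <= b -> cnorm (h t) <= M) -> cnorm (cint a b h) <= 2 * M * (b - a).
Proof.
move=> ab hc hM; rewrite (le_trans (cnorm_leReIm _))//=.
rewrite -mulrA mulr_natl mulr2n; apply: lerD; apply: rint_norm => //.
- exact: cts_Re.
- by move=> t /hM; apply: le_trans; exact: cRe_le.
- exact: cts_Im.
- by move=> t /hM; apply: le_trans; exact: cIm_le.
Qed.

Let proj_deriv (p : C -> R) (h : R -> C) t (l : C) : (forall x y, p (x - y) = p x - p y) ->
  (forall x, `|p x| <= cnorm x) -> (forall x s, p (x * cof s) = p x * s) ->
  rcderiv h t l -> is_derive t 1 (fun s => p (h s)) (p l).
Proof.
move=> pB ple pM dh.
have H : (fun s : R => s^-1 *: (((fun s => p (h s)) \o shift t) (s *: (1:R))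
    - p (h t))) @ 0^' --> p l.
  apply/cvgrPdist_le => /= e e0; have [d d0 H] := dh _ e0.
  exists d => //= s; rewrite /= sub0r normrN => sd s0.
  have sg0 : 0 < `|s| by rewrite normr_gt0.
  rewrite -(ler_pM2r sg0) -normrM [s *: 1]mulr1 (addrC s) -pB.
  rewrite /GRing.scale/= mulrBl mulrAC mulVf// mul1r -pM -pB.
  apply: le_trans (ple _) _; rewrite cnorm_distC; exact: H.
apply: DeriveDef; first by apply/cvg_ex; exists (p l).
exact: cvg_lim H.
Qed.

Lemma cint_FTC a b h (H : R -> C) : a <= b -> cts_on a b h ->
  (forall t, a <= t <= b -> rcderiv H t (h t)) -> cint a b h = H b - H a.
Proof.
move=> ab hc dH; apply: c_eqP; rewrite ?cReB ?cImB /=.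
  apply: (rint_FTC (G := fun t => cRe (H t))) => //; first exact: cts_Re.
  move=> t /dH; apply: proj_deriv => *; rewrite ?cReB ?cRe_le//.
  by rewrite cReM /= mulr0 subr0.
apply: (rint_FTC (G := fun t => cIm (H t))) => //; first exact: cts_Im.
move=> t /dH; apply: proj_deriv => *; rewrite ?cImB ?cIm_le//.
by rewrite cImM /= mulr0 add0r.
Qed.

(** Chain rule along a line. Scaling by [1 + cnorm q] instead of [cnorm q] avoids a separate case
    [q = 0]. *)
Lemma rcderiv_line (f : C -> C) (p q : C) t l :
  cderiv f (p + cof t * q) l -> rcderiv (fun t => f (p + cof t * q)) t (l * q).
Proof.
move=> df e e0; have q0 : 0 < 1 + cnorm q by rewrite ltr_pwDl// cnorm_ge0.
have [d d0 H] := df (e / (1 + cnorm q)) (divr_gt0 e0 q0).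
exists (d / (1 + cnorm q)); first exact: divr_gt0.
move=> s; rewrite ltr_pdivlMr// => sd.
have lq : cnorm (cof s * q) <= `|s| * (1 + cnorm q).
  by rewrite cnormM cnorm_cof ler_wpM2l// lerDr.
have := H (cof s * q) (le_lt_trans lq sd).
rewrite cofD mulrDl addrA -(mulrA l) (mulrC q) => /le_trans; apply.
rewrite -mulrA ler_wpM2l// ?(ltW e0)//.
by rewrite mulrC ler_pdivrMr// (le_trans lq)// lerDl.
Qed.

Lemma rccont_line (f : C -> C) (p q : C) t :
  ccont f (p + cof t * q) -> rccont (fun t => f (p + cof t * q)) t.
Proof.
move=> fc e e0; have q0 : 0 < 1 + cnorm q by rewrite ltr_pwDl// cnorm_ge0.
have [d d0 H] := fc _ e0; exists (d / (1 + cnorm q)); first exact: divr_gt0.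
move=> s; rewrite ltr_pdivlMr// => sd.
rewrite cofD mulrDl addrA; apply: H.
rewrite cnormM cnorm_cof (le_lt_trans _ sd)// ler_wpM2l// lerDr//.
Qed.

End CurveIntegral.

(** * Nested intervals and bisection of rectangles *)

Section Bisection.
Variable R : realType.
Implicit Types (a b c d x : R) (I : R * R).

Lemma exists_gt_expr2 x : exists n, x < 2 ^+ n.
Proof.
exists (Num.bound `|x|); apply: lt_le_trans (_ : (Num.bound `|x|)%:R <= _).
  by apply: le_lt_trans (ler_norm _) _; rewrite archi_boundP.
by rewrite -natrX ler_nat ltnW// ltn_expl.
Qed.

Definition half (s : bool) I : R * R :=
  if s then (I.1, (I.1 + I.2) / 2) else ((I.1 + I.2) / 2, I.2).

(** Left endpoints increase and stay below every right endpoint, so their supremum lies in all the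
    intervals. *)
Lemma nested_halves (I : nat -> R * R) (s : nat -> bool) :
  (I 0%N).1 <= (I 0%N).2 -> (forall n, I n.+1 = half (s n) (I n)) ->
  [/\ (forall n, (I 0%N).1 <= (I n).1 /\ (I n).2 <= (I 0%N).2),
      (forall n, ((I n).2 - (I n).1) * 2 ^+ n = (I 0%N).2 - (I 0%N).1) &
      exists p, forall n, (I n).1 <= p <= (I n).2].
Proof.
move=> I0 IS.
have le n : (I n).1 <= (I n).2.
  by elim: n => // n IH; rewrite IS /half; case: (s n) => /=; lra.
have mono n m : (I n).1 <= (I (n + m)%N).1 /\ (I (n + m)%N).2 <= (I n).2.
  elim: m => [|m]; first by rewrite addn0.
  rewrite addnS IS /half; have := le (n + m)%N.
  by case: (s _) => /= ? []; lra.
split.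
- by move=> n; exact: (mono 0%N n).
- elim=> [|n IH]; first by rewrite expr0 mulr1.
  by rewrite -IH IS /half exprS; case: (s n) => /=; field.
have lr n m : (I n).1 <= (I m).2.
  have [nm|mn] := leqP n m.
    by have [+ _] := mono n (m - n)%N; rewrite subnKC// => /le_trans; apply.
  by have [_] := mono m (n - m)%N; rewrite subnKC ?(ltnW mn)//; apply: le_trans.
exists (sup [set (I n).1 | n in setT]) => n; apply/andP; split.
  apply: ub_le_sup; last by exists n.
  by exists (I 0%N).2 => _ [m _ <-].
apply: ge_sup; first by exists (I 0%N).1; exists 0%N.
by move=> _ [m _ <-].
Qed.

(* Cousin-style compactness argument, in place of topological compactness. *)
Lemma bisection (B : R -> R -> R -> R -> Prop) a b c d :
  a <= b -> c <= d ->
  (forall a' b' c' d', a <= a' <= b' -> b' <= b -> c <= c' <= d' -> d' <= d ->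
    let m := (a' + b') / 2 in let n := (c' + d') / 2 in
    B a' m c' n -> B m b' c' n -> B a' m n d' -> B m b' n d' -> B a' b' c' d') ->
  (forall p q, a <= p <= b -> c <= q <= d -> exists2 e, 0 < e &
    forall a' b' c' d', a <= a' -> b' <= b -> c <= c' -> d' <= d ->
      a' <= p <= b' -> c' <= q <= d' -> (b' - a') + (d' - c') < e ->
      B a' b' c' d') ->
  B a b c d.
Proof.
move=> ab cd glue loc; apply: contrapT => nB.
pose BB (Q : (R * R) * (R * R)) := B Q.1.1 Q.1.2 Q.2.1 Q.2.2.
pose ok (Q : (R * R) * (R * R)) := [/\ a <= Q.1.1 <= Q.1.2, Q.1.2 <= b,
  c <= Q.2.1 <= Q.2.2 & Q.2.2 <= d].
pose qu (s : bool * bool) (Q : (R * R) * (R * R)) := (half s.1 Q.1, half s.2 Q.2).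
(* If all four quarters of a bad rectangle were good, gluing would make it good; so some quarter is
   bad. Keeping the hypotheses inside the existential makes the choice function total. *)
have /choice[pick pickP] : forall Q, exists s, ok Q -> ~ BB Q -> ~ BB (qu s Q).
  move=> Q; have [[okQ nQ]|H] := pselect (ok Q /\ ~ BB Q); last first.
    by exists (true, true) => ? ?; case: H.
  apply: contrapT => H.
  have HB s : BB (qu s Q).
    by apply: contrapT => ns; apply: H; exists s.
  apply: nQ; case: Q okQ {H} HB => [[a' b'] [c' d']] [/= h1 h2 h3 h4] HB.
  apply: glue => //.
  - exact: (HB (true, true)).
  - exact: (HB (false, true)).
  - exact: (HB (true, false)).
  - exact: (HB (false, false)).
pose Q n := iter n (fun Q => qu (pick Q) Q) ((a, b), (c, d)).
have [A1 A2 [p Hp]] :=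
  @nested_halves (fun n => (Q n).1) (fun n => (pick (Q n)).1) ab (fun=> erefl).
have [C1 C2 [q Hq]] :=
  @nested_halves (fun n => (Q n).2) (fun n => (pick (Q n)).2) cd (fun=> erefl).
have okQ n : ok (Q n).
  have [? ?] := A1 n; have [? ?] := C1 n.
  have /andP[? ?] := Hp n; have /andP[? ?] := Hq n.
  by split; rewrite /= in A1 *; rewrite //=; apply/andP; split => //; lra.
have nQ n : ~ BB (Q n).
  by elim: n => // n IH; apply: pickP.
(* The bad rectangles shrink to (p, q), so a late one is small enough for the local hypothesis
   there, a contradiction. *)
have [e e0 He] := loc p q (Hp 0%N) (Hq 0%N).
have [n nn] := exists_gt_expr2 (((b - a) + (d - c)) / e).
have [? ?] := A1 n; have [? ?] := C1 n.
apply: (nQ n); apply: He => //.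
rewrite -(ltr_pM2r (_ : 0 < 2 ^+ n)) ?exprn_gt0// mulrDl A2 C2 /=.
by rewrite mulrC -ltr_pdivrMr.
Qed.

End Bisection.

(** * Contour integrals over rectangles and Goursat's theorem *)

Section Rectangle.
Variable R : realType.
Local Notation C := (Cx R).
Implicit Types (a b c d m t k : R) (F G : C -> C) (z w l : C).

Definition hcont F c a b := cts_on a b (fun t => F (mkc t c)).
Definition vcont F a c d := cts_on c d (fun t => F (mkc a t)).

Definition rect a b c d z := a <= cRe z <= b /\ c <= cIm z <= d.

Definition rbd a b c d z :=
  [\/ exists2 t, a <= t <= b & z = mkc t c, exists2 t, a <= t <= b & z = mkc t d,
      exists2 t, c <= t <= d & z = mkc a t | exists2 t, c <= t <= d & z = mkc b t].

(* counterclockwise contour integral over the boundary of [a, b] x [c, d] *)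
Definition Phi F a b c d : C :=
  cint a b (fun t => F (mkc t c)) - cint a b (fun t => F (mkc t d)) +
  ci R * (cint c d (fun t => F (mkc b t)) - cint c d (fun t => F (mkc a t))).

Definition bdcont F a b c d := forall z, rbd a b c d z -> ccont F z.

Lemma mkc_h t c : mkc t c = mkc 0 c + cof t * 1.
Proof. by apply: c_eqP; rewrite ?cReD ?cImD ?cReM ?cImM /=; ring. Qed.
Lemma mkc_v a t : mkc a t = mkc a 0 + cof t * ci R.
Proof. by apply: c_eqP; rewrite ?cReD ?cImD ?cReM ?cImM /=; ring. Qed.

Lemma rccont_h F t c : ccont F (mkc t c) -> rccont (fun t => F (mkc t c)) t.
Proof.
have -> : (fun t => F (mkc t c)) = (fun t => F (mkc 0 c + cof t * 1)).
  by apply/funext => s; rewrite mkc_h.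
by rewrite mkc_h; exact: rccont_line.
Qed.
Lemma rccont_v F a t : ccont F (mkc a t) -> rccont (fun t => F (mkc a t)) t.
Proof.
have -> : (fun t => F (mkc a t)) = (fun t => F (mkc a 0 + cof t * ci R)).
  by apply/funext => s; rewrite mkc_v.
by rewrite mkc_v; exact: rccont_line.
Qed.
Lemma rcderiv_h F t c l : cderiv F (mkc t c) l -> rcderiv (fun t => F (mkc t c)) t l.
Proof.
have -> : (fun t => F (mkc t c)) = (fun t => F (mkc 0 c + cof t * 1)).
  by apply/funext => s; rewrite mkc_h.
by rewrite mkc_h => /rcderiv_line; rewrite mulr1.
Qed.
Lemma rcderiv_v F a t l : cderiv F (mkc a t) l -> rcderiv (fun t => F (mkc a t)) t (ci R * l).
Proof.
have -> : (fun t => F (mkc a t)) = (fun t => F (mkc a 0 + cof t * ci R)).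
  by apply/funext => s; rewrite mkc_v.
by rewrite mkc_v => /rcderiv_line; rewrite mulrC.
Qed.

Lemma bdcontP F a b c d : bdcont F a b c d ->
  [/\ hcont F c a b, hcont F d a b, vcont F a c d & vcont F b c d].
Proof.
move=> H; split => t tab; do ?[apply: rccont_h|apply: rccont_v]; apply: H.
- by constructor 1; exists t.
- by constructor 2; exists t.
- by constructor 3; exists t.
- by constructor 4; exists t.
Qed.

Lemma Phi_splitv F a m b c d : a <= m <= b -> hcont F c a b -> hcont F d a b ->
  Phi F a b c d = Phi F a m c d + Phi F m b c d.
Proof.
move=> amb h1 h2; rewrite /Phi (cint_split amb h1) (cint_split amb h2).
by ring.
Qed.

Lemma Phi_splith F a b c m d : c <= m <= d -> vcont F a c d -> vcont F b c d ->
  Phi F a b c d = Phi F a b c m + Phi F a b m d.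
Proof.
move=> cmd h1 h2; rewrite /Phi (cint_split cmd h1) (cint_split cmd h2).
by ring.
Qed.

Lemma PhiD F G a b c d : bdcont F a b c d -> bdcont G a b c d ->
  Phi (fun z => F z + G z) a b c d = Phi F a b c d + Phi G a b c d.
Proof.
move=> /bdcontP[? ? ? ?] /bdcontP[? ? ? ?].
by rewrite /Phi !cintD//; ring.
Qed.

Lemma PhiB F G a b c d : bdcont F a b c d -> bdcont G a b c d ->
  Phi (fun z => F z - G z) a b c d = Phi F a b c d - Phi G a b c d.
Proof.
move=> /bdcontP[? ? ? ?] /bdcontP[? ? ? ?].
by rewrite /Phi !cintB//; ring.
Qed.

Lemma PhiZ (k : C) F a b c d : bdcont F a b c d ->
  Phi (fun z => k * F z) a b c d = k * Phi F a b c d.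
Proof.
move=> /bdcontP[? ? ? ?].
by rewrite /Phi !cintZ//; ring.
Qed.

Lemma Phi_ext F G a b c d : (forall z, rbd a b c d z -> F z = G z) ->
  Phi F a b c d = Phi G a b c d.
Proof.
move=> H; rewrite /Phi /cint /rint; congr (mkc _ _ - mkc _ _ + _ * (mkc _ _ - mkc _ _));
  apply: eq_Rintegral => t; rewrite inE/= in_itv/= => tab; rewrite H//.
all: by [constructor 1; exists t|constructor 2; exists t
        |constructor 3; exists t|constructor 4; exists t].
Qed.

Lemma ci_norm : cnorm (ci R) = 1.
Proof. by rewrite /cnorm /= expr0n/= add0r expr1n sqrtr1. Qed.

(** The constant 4 is the 2 of [cint_norm] times the two parallel edges in each direction. *)
Lemma Phi_norm F a b c d M : a <= b -> c <= d -> bdcont F a b c d ->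
  (forall z, rbd a b c d z -> cnorm (F z) <= M) ->
  cnorm (Phi F a b c d) <= 4 * M * ((b - a) + (d - c)).
Proof.
move=> ab cd /bdcontP[h1 h2 v1 v2] FM.
have H1 := cint_norm ab h1 (fun t tab => FM _ (Or41 _ _ _ (ex_intro2 _ _ t tab erefl))).
have H2 := cint_norm ab h2 (fun t tab => FM _ (Or42 _ _ _ (ex_intro2 _ _ t tab erefl))).
have H3 := cint_norm cd v1 (fun t tab => FM _ (Or43 _ _ _ (ex_intro2 _ _ t tab erefl))).
have H4 := cint_norm cd v2 (fun t tab => FM _ (Or44 _ _ _ (ex_intro2 _ _ t tab erefl))).
rewrite /Phi; apply: le_trans (cnormD _ _) _.
rewrite cnormM ci_norm mul1r.
have := cnormB (cint a b (fun t => F (mkc t c))) (cint a b (fun t => F (mkc t d))).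
have := cnormB (cint c d (fun t => F (mkc b t))) (cint c d (fun t => F (mkc a t))).
lra.
Qed.

(** Each edge contributes a difference of corner values of [G], and these cancel around the contour.
    On vertical edges the factor i is moved into the integrand, where it is the derivative of the
    parametrisation. *)
Lemma Phi_prim F G a b c d : a <= b -> c <= d -> bdcont F a b c d ->
  (forall z, rbd a b c d z -> cderiv G z (F z)) -> Phi F a b c d = 0.
Proof.
move=> ab cd /bdcontP[h1 h2 v1 v2] FG; rewrite /Phi.
rewrite (cint_FTC (H := fun t => G (mkc t c)) ab h1); last first.
  by move=> t tab; apply: rcderiv_h; apply: FG; constructor 1; exists t.
rewrite (cint_FTC (H := fun t => G (mkc t d)) ab h2); last first.
  by move=> t tab; apply: rcderiv_h; apply: FG; constructor 2; exists t.
rewrite mulrBr -!cintZ//.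
have vc (x : R) : vcont F x c d -> cts_on c d (fun t => ci R * F (mkc x t)).
  move=> v t tcd e e0; have [u u0 H] := v t tcd e e0; exists u => // s su.
  by rewrite -mulrBr cnormM ci_norm mul1r H.
rewrite (cint_FTC (H := fun t => G (mkc b t)) cd (vc _ v2)); last first.
  by move=> t tab; apply: rcderiv_v; apply: FG; constructor 4; exists t.
rewrite (cint_FTC (H := fun t => G (mkc a t)) cd (vc _ v1)); last first.
  by move=> t tab; apply: rcderiv_v; apply: FG; constructor 3; exists t.
by ring.
Qed.

Lemma rbd_rect a b c d z : a <= b -> c <= d -> rbd a b c d z -> rect a b c d z.
Proof. by move=> ab cd [] [t tab ->]; split; rewrite /= ?lexx ?ab ?cd. Qed.

Lemma rectS a b c d a' b' c' d' z : a <= a' -> b' <= b -> c <= c' -> d' <= d ->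
  rect a' b' c' d' z -> rect a b c d z.
Proof. by move=> ? ? ? ? [/andP[? ?] /andP[? ?]]; split; apply/andP; split; lra. Qed.

Lemma rect_dist a b c d z w : rect a b c d z -> rect a b c d w ->
  cnorm (z - w) <= (b - a) + (d - c).
Proof.
move=> [/andP[? ?] /andP[? ?]] [/andP[? ?] /andP[? ?]].
apply: le_trans (cnorm_leReIm _) _; rewrite cReD cReN cImD cImN.
by apply: lerD; rewrite ler_norml; apply/andP; split; lra.
Qed.

(** The bound k L^2, with L the sum of the side lengths, is proved for every k > 0 by [bisection];
    letting k tend to 0 gives the claim. *)
Lemma Goursat F a b c d : a <= b -> c <= d ->
  (forall z, rect a b c d z -> exists l, cderiv F z l) -> Phi F a b c d = 0.
Proof.
move=> ab cd dF.
have bc a' b' c' d' : a <= a' <= b' -> b' <= b -> c <= c' <= d' -> d' <= d ->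
    bdcont F a' b' c' d'.
  move=> /andP[? ?] ? /andP[? ?] ? z /rbd_rect rz.
  have [|l] := dF z; last exact: cderiv_cont.
  by apply: (@rectS _ _ _ _ a' b' c' d') => //; apply: rz.
suff H k : 0 < k -> cnorm (Phi F a b c d) <= k * ((b - a) + (d - c)) ^+ 2.
  apply/eqP; rewrite -cnorm_eq0; apply/eqP/le_anti; rewrite cnorm_ge0 andbT.
  apply/ler_addgt0Pr => e e0; rewrite add0r.
  set L := (b - a) + (d - c) in H *.
  have L0 : 0 < L ^+ 2 + 1 by rewrite ltr_wpDl// sqr_ge0.
  apply: le_trans (H (e / (L ^+ 2 + 1)) _) _; first exact: divr_gt0.
  by rewrite mulrAC ler_pdivrMr// ler_wpM2l ?(ltW e0)// lerDl.
move=> k0; pose B a b c d := cnorm (Phi F a b c d) <= k * ((b - a) + (d - c)) ^+ 2.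
apply: (@bisection _ B) => //.
  move=> a' b' c' d' h1 h2 h3 h4 m n B1 B2 B3 B4.
  have [g1 g2 g3 g4] := bdcontP (bc _ _ _ _ h1 h2 h3 h4).
  have {}h1 := h1; move/andP: (h1) => [aa' ab']; move/andP: (h3) => [cc' cd'].
  have am : a' <= m <= b' by rewrite /m; apply/andP; split; lra.
  have cn : c' <= n <= d' by rewrite /n; apply/andP; split; lra.
  move/andP: (am) => [am1 am2]; move/andP: (cn) => [cn1 cn2].
  have [_ _ _ g5] := bdcontP
    (bc a' m c' d' (introT andP (conj aa' am1)) (le_trans am2 h2) h3 h4).
  rewrite /B (Phi_splitv am g1 g2) (Phi_splith cn g3 g5) (Phi_splith cn g5 g4).
  (* Each quarter has half the side sum, hence a quarter of its square: the four bounds add up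
     exactly, and gluing loses nothing. *)
  have -> : k * (b' - a' + (d' - c')) ^+ 2 =
      k * (m - a' + (n - c')) ^+ 2 + k * (m - a' + (d' - n)) ^+ 2
      + (k * (b' - m + (n - c')) ^+ 2 + k * (b' - m + (d' - n)) ^+ 2).
    by rewrite /m /n; field.
  by do 3 ?[apply: le_trans (cnormD _ _) _; apply: lerD].
move=> p q pab qcd; have [l dl] := dF (mkc p q) (conj pab qcd).
(* Dividing by 4 offsets the constant of [Phi_norm]. *)
have [e e0 He] := dl (k / 4) (divr_gt0 k0 (ltr0n _ 4)).
exists e => // a' b' c' d' aa bb cc dd pa qc Le.
have ab' : a' <= b' by move/andP: pa => []; exact: le_trans.
have cd' : c' <= d' by move/andP: qc => []; exact: le_trans.
have h1 : a <= a' <= b' by rewrite aa.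
have h3 : c <= c' <= d' by rewrite cc.
have FC := bc _ _ _ _ h1 bb h3 dd.
(* The first-order part of [F] has a quadratic primitive, so it integrates to zero. What remains is
   at most (k / 4) L on a contour of side sum L. *)
pose A z := F (mkc p q) + l * (z - mkc p q).
have dA z : cderiv (fun z => (F (mkc p q) - l * mkc p q) * z + (l / 2) * z ^+ 2) z (A z).
  have -> : A z = (F (mkc p q) - l * mkc p q) * 1 + (l / 2) * (2%:R * z ^+ 1).
    by rewrite /A; field.
  by apply: cderivD; apply: cderivZ; [exact: cderiv_id|exact: (cderivX 2)].
have dA' z : cderiv A z (0 + l * (1 - 0)).
  apply: cderivD; first exact: cderiv_cst.
  by apply: cderivZ; apply: cderivB; [exact: cderiv_id|exact: cderiv_cst].
have AC : bdcont A a' b' c' d' by move=> z _; exact: cderiv_cont (dA' z).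
have E : Phi (fun z => F z - A z) a' b' c' d' = Phi F a' b' c' d'.
  rewrite PhiB// (Phi_prim ab' cd' AC (fun z _ => dA z)).
  by rewrite subr0.
rewrite /B -E; set L := _ + _ in Le *.
have -> : k * L ^+ 2 = 4 * (k / 4 * L) * L by field.
apply: Phi_norm => //.
  move=> z zb u u0; have [l1 d1] : exists l, cderiv F z l.
    by apply: dF; apply: (@rectS _ _ _ _ a' b' c' d') => //; exact: rbd_rect.
  exact: (cderiv_cont (cderivB d1 (dA' z))).
move=> z /(rbd_rect ab' cd') rz.
have zL : cnorm (z - mkc p q) <= L by apply: rect_dist.
have := He (z - mkc p q) (le_lt_trans zL Le).
rewrite subrKC /A opprD addrA => /le_trans; apply.
by rewrite ler_wpM2l// divr_ge0 ?(ltW k0).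
Qed.

(** Away from a small square of half-side v about the exceptional point [Goursat] applies;
    boundedness makes the contribution of that square at most 16 M v, which tends to 0. *)
Lemma Goursat_punctured F a b c d p q M e : a < p < b -> c < q < d -> 0 < e ->
  (forall z, rect a b c d z -> z != mkc p q -> exists l, cderiv F z l) ->
  (forall z, cnorm (z - mkc p q) < e -> z != mkc p q -> cnorm (F z) <= M) ->
  Phi F a b c d = 0.
Proof.
move=> /andP[ap pb] /andP[cq qd] e0 dF FM.
(* Any [v < u] keeps the small square inside the rectangle and, since 4 v < e / 2, inside the disc
   where [M] bounds [F]. *)
pose u := Num.min (Num.min (p - a) (b - p)) (Num.min (Num.min (q - c) (d - q)) (e / 8)).
have u0 : 0 < u by rewrite !lt_min !subr_gt0 ap pb cq qd divr_gt0.
have M0 : 0 <= M.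
  apply: le_trans (cnorm_ge0 _) (FM (mkc (p + e / 2) q) _ _).
    apply: le_lt_trans (cnorm_leReIm _) _; rewrite cReD cReN cImD cImN /= subrr normr0 addr0.
    by rewrite addrAC subrr add0r gtr0_norm; lra.
  by apply/eqP => -[]; lra.
suff H v : 0 < v < u -> cnorm (Phi F a b c d) <= 16 * M * v.
  apply/eqP; rewrite -cnorm_eq0; apply/eqP/le_anti; rewrite cnorm_ge0 andbT.
  apply/ler_addgt0Pr => x x0; rewrite add0r.
  have M1 : 0 < 16 * M + 1 by lra.
  pose v := Num.min (u / 2) (x / (16 * M + 1)).
  have v0 : 0 < v by rewrite lt_min !divr_gt0.
  have vu : v < u by rewrite gt_min; apply/orP; left; lra.
  apply: le_trans (H v _) _; first by rewrite v0.
  have : v <= x / (16 * M + 1) by rewrite ge_min lexx orbT.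
  rewrite ler_pdivlMr// => vx.
  by rewrite (le_trans _ vx)//; lra.
move=> /andP[v0]; rewrite !lt_min => /andP[/andP[v1 v2] /andP[/andP[v3 v4] v5]].
have bc a' b' c' d' : a <= a' -> a' <= b' -> b' <= b -> c <= c' -> c' <= d' -> d' <= d ->
    ~ rbd a' b' c' d' (mkc p q) -> bdcont F a' b' c' d'.
  move=> ? ? ? ? ? ? nz z zb; have [||l] := dF z; last exact: cderiv_cont.
    by apply: (@rectS _ _ _ _ a' b' c' d') => //; apply: rbd_rect.
  by apply/eqP => E; apply: nz; rewrite -E.
have nbd a' b' c' d' : a' != p -> b' != p -> c' != q -> d' != q -> ~ rbd a' b' c' d' (mkc p q).
  by move=> /eqP h1 /eqP h2 /eqP h3 /eqP h4 [] [t _ [*]]; congruence.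
have Z a' b' c' d' : a <= a' -> a' <= b' -> b' <= b -> c <= c' -> c' <= d' -> d' <= d ->
    [\/ b' < p, p < a', d' < q | q < c'] -> Phi F a' b' c' d' = 0.
  move=> ? ? ? ? ? ? H; apply: Goursat => // z rz; apply: dF.
    exact: rectS rz.
  apply/eqP => E; move: rz; rewrite E => -[/= /andP[? ?] /andP[? ?]].
  by case: H; lra.
have p1 : a <= p - v <= b by apply/andP; split; lra.
have p2 : p - v <= p + v <= b by apply/andP; split; lra.
have q1 : c <= q - v <= d by apply/andP; split; lra.
have q2 : q - v <= q + v <= d by apply/andP; split; lra.
have neq (x y : R) : x < y \/ y < x -> x != y by move=> xy; apply/eqP; lra.
have [g1 g2 _ _] : [/\ hcont F c a b, hcont F d a b, vcont F a c d & vcont F b c d].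
  by apply: bdcontP; apply: bc; do ?[apply: nbd; apply: neq]; lra.
have [g3 g4 _ _] : [/\ hcont F c (p-v) b, hcont F d (p-v) b, vcont F (p-v) c d & vcont F b c d].
  by apply: bdcontP; apply: bc; do ?[apply: nbd; apply: neq]; lra.
have [_ _ g5 g6] : [/\ hcont F c (p-v) (p+v), hcont F d (p-v) (p+v),
     vcont F (p-v) c d & vcont F (p+v) c d].
  by apply: bdcontP; apply: bc; do ?[apply: nbd; apply: neq]; lra.
have [_ _ g7 g8] : [/\ hcont F (q-v) (p-v) (p+v), hcont F d (p-v) (p+v),
     vcont F (p-v) (q-v) d & vcont F (p+v) (q-v) d].
  by apply: bdcontP; apply: bc; do ?[apply: nbd; apply: neq]; lra.
(* The regions left, right, below and above the small square are peeled off in turn, each with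
   integral zero. *)
rewrite (Phi_splitv p1 g1 g2) (Z a (p - v)); try lra; last by constructor 1; lra.
rewrite add0r (Phi_splitv p2 g3 g4) (Z (p + v) b); try lra; last by constructor 2; lra.
rewrite addr0 (Phi_splith q1 g5 g6) (Z _ _ c (q - v)); try lra; last by constructor 3; lra.
rewrite add0r (Phi_splith q2 g7 g8) (Z _ _ (q + v) d); try lra; last by constructor 4; lra.
rewrite addr0.
have -> : 16 * M * v = 4 * M * ((p + v - (p - v)) + (q + v - (q - v))) by ring.
apply: Phi_norm; try lra.
  by apply: bc; do ?[apply: nbd; apply: neq]; lra.
move=> z zb; apply: FM; last first.
  apply/eqP => E; move: zb; rewrite E; apply: nbd; apply: neq; lra.
have rw : rect (p - v) (p + v) (q - v) (q + v) (mkc p q).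
  by split; apply/andP; split => /=; lra.
apply: le_lt_trans (rect_dist (rbd_rect _ _ zb) rw) _; lra.
Qed.

(** Boundedness holds locally by continuity and passes from the four quarters to the whole by adding
    the bounds, so [bisection] applies. *)
Lemma rect_bounded F a b c d : a <= b -> c <= d ->
  (forall z, rect a b c d z -> ccont F z) ->
  exists2 M, 0 <= M & forall z, rect a b c d z -> cnorm (F z) <= M.
Proof.
move=> ab cd Fc.
pose B a b c d := exists2 M, 0 <= M & forall z, rect a b c d z -> cnorm (F z) <= M.
apply: (@bisection _ B) => //.
  move=> a' b' c' d' h1 h2 h3 h4 m n [M1 M10 H1] [M2 M20 H2] [M3 M30 H3] [M4 M40 H4].
  exists (M1 + M2 + M3 + M4); first by rewrite !addr_ge0.
  move=> z [/andP[z1 z2] /andP[z3 z4]].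
  have [zm|/ltW zm] := leP (cRe z) m; have [zn|/ltW zn] := leP (cIm z) n.
  - by have := H1 z (conj (introT andP (conj z1 zm)) (introT andP (conj z3 zn))); lra.
  - by have := H3 z (conj (introT andP (conj z1 zm)) (introT andP (conj zn z4))); lra.
  - by have := H2 z (conj (introT andP (conj zm z2)) (introT andP (conj z3 zn))); lra.
  - by have := H4 z (conj (introT andP (conj zm z2)) (introT andP (conj zn z4))); lra.
move=> p q pab qcd; have [e e0 He] := Fc (mkc p q) (conj pab qcd) 1 ltr01.
exists e => // a' b' c' d' _ _ _ _ pa qc Le.
exists (1 + cnorm (F (mkc p q))); first by rewrite addr_ge0// cnorm_ge0.
move=> z rz; have zL := rect_dist rz (conj pa qc : rect a' b' c' d' (mkc p q)).
have := He _ (le_lt_trans zL Le); rewrite subrKC.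
have := cnorm_subr (F z) (F (mkc p q)); lra.
Qed.

End Rectangle.

(** * From Cauchy's formula on a square to power series *)

Section Cauchy.
Variable R : realType.
Local Notation C := (Cx R).
Implicit Types (s : R) (f g : C -> C) (z w : C) (a b : nat -> C).

(* The quantified remainder bound encodes convergence without limits: products,
   uniqueness and differentiation become finite estimates. *)
Definition ps a f := exists K : R, exists2 s : R, 0 <= K /\ 0 < s &
  forall n z, s * cnorm z <= 1 ->
    cnorm (f z - \sum_(k < n) a k * z ^+ k) <= K * (s * cnorm z) ^+ n.

Definition bdder s f := forall z, rbd (- s) s (- s) s z -> exists l, cderiv f z l.

Lemma bdder_cont s f : bdder s f -> bdcont f (- s) s (- s) s.
Proof. by move=> H z /H [l]; exact: cderiv_cont. Qed.

Lemma bdderM s f g : bdder s f -> bdder s g -> bdder s (fun z => f z * g z).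
Proof.
by move=> F G z zb; have [l dl] := F z zb; have [m dm] := G z zb; eexists; exact: cderivM dl dm.
Qed.

Lemma bdderV s f : (forall z, rbd (- s) s (- s) s z -> f z != 0) -> bdder s f ->
  bdder s (fun z => (f z)^-1).
Proof.
by move=> N F z zb; have [l dl] := F z zb; eexists; apply: cderivV dl; exact: N.
Qed.

Lemma invc_mkc (x y : R) : (mkc x y)^-1 = mkc (x / (x ^+ 2 + y ^+ 2)) (- (y / (x ^+ 2 + y ^+ 2))).
Proof. by []. Qed.

Lemma rbd_norm s z : 0 < s -> rbd (- s) s (- s) s z -> s <= cnorm z.
Proof.
move=> s0 [] [t _ ->].
- by apply: le_trans (cIm_le _); rewrite /= normrN ger0_norm// ltW.
- by apply: le_trans (cIm_le _); rewrite /= ger0_norm// ltW.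
- by apply: le_trans (cRe_le _); rewrite /= normrN ger0_norm// ltW.
- by apply: le_trans (cRe_le _); rewrite /= ger0_norm// ltW.
Qed.

Lemma norm_neq0 z : 0 < cnorm z -> z != 0. Proof. by rewrite cnorm_gt0. Qed.

Lemma rbd_neq0 s z : 0 < s -> rbd (- s) s (- s) s z -> z != 0.
Proof. by move=> s0 /(rbd_norm s0) sz; apply: norm_neq0; exact: lt_le_trans sz. Qed.

Lemma rbd_sub s z w : 0 < s -> cnorm w <= s / 2 -> rbd (- s) s (- s) s z ->
  s / 2 <= cnorm (z - w).
Proof. by move=> s0 ws /(rbd_norm s0) sz; have := cnorm_subr z w; lra. Qed.

Section Square.
Variable s : R.
Hypothesis s0 : 0 < s.
Local Notation Sq f := (Phi f (- s) s (- s) s).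
Let sN : - s <= s. Proof. by move: s0; lra. Qed.
Let s2 : 0 < s / 2. Proof. by move: s0; lra. Qed.

Lemma bdder_subV w : cnorm w <= s / 2 -> bdder s (fun z => (z - w)^-1).
Proof.
move=> ws; apply: (@bdderV _ (fun z => z - w)).
  move=> z /(rbd_sub s0 ws) H; apply: norm_neq0; apply: lt_le_trans H; exact: s2.
by move=> z _; exists (1 - 0); apply: cderivB; [exact: cderiv_id|exact: cderiv_cst].
Qed.

Lemma bdder_expV n : bdder s (fun z => (z ^+ n)^-1).
Proof.
apply: (@bdderV _ (fun z => z ^+ n)).
  by move=> z /(rbd_neq0 s0); exact: expf_neq0.
by move=> z _; eexists; exact: cderivX.
Qed.

(** On each edge the component of 1/z that enters the imaginary part has constant sign and modulus
    at least 1 / (2 s). Over length 2 s every edge adds at least 1, whence the bound 4. *)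
Lemma Sq_inv_neq0 : Sq (fun z => z^-1) != 0.
Proof.
suff : 4 <= cIm (Sq (fun z => z^-1)).
  by apply: contraTneq => ->; rewrite -ltNge ltr0n.
have bc : bdcont (fun z => z^-1) (- s) s (- s) s.
  by have := bdder_cont (@bdder_expV 1).
have [h1 h2 v1 v2] := bdcontP bc.
rewrite /Phi cImD cImD cImN cImM cReD cReN /= mul0r add0r mul1r.
have sq t : - s <= t <= s -> 0 <= t ^+ 2 <= s ^+ 2.
  move=> /andP[t1 t2]; rewrite sqr_ge0/= -ler_sqrt ?sqr_ge0// !sqrtr_sqr.
  by rewrite (ger0_norm (ltW s0)) ler_norml t1.
have low t : - s <= t <= s -> (2 * s)^-1 <= s / (t ^+ 2 + s ^+ 2).
  move=> /sq/andP[t0 ts]; have ss : 0 < s ^+ 2 by rewrite exprn_gt0.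
  have D : 0 < t ^+ 2 + s ^+ 2 by lra.
  rewrite ler_pdivlMr// mulrC ler_pdivrMr ?mulr_gt0//.
  by have : s * (2 * s) = 2 * s ^+ 2 by [ring]; lra.
have cst (g : R -> R) : {in `[(- s), s], continuous g} ->
    (forall t, - s <= t <= s -> (2 * s)^-1 <= g t) -> 1 <= rint (- s) s g.
  move=> gc gl.
  have -> : 1 = rint (- s) s (fun=> (2 * s)^-1).
    by rewrite rint_cst//; field; rewrite gt_eqF.
  by apply: rint_le => //; exact: cst_continuous_in.
have cstN (g : R -> R) : {in `[(- s), s], continuous g} ->
    (forall t, - s <= t <= s -> g t <= - (2 * s)^-1) -> rint (- s) s g <= -1.
  move=> gc gl.
  have -> : -1 = rint (- s) s (fun=> - (2 * s)^-1).
    by rewrite rint_cst//; field; rewrite gt_eqF.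
  by apply: rint_le => //; exact: cst_continuous_in.
have H1 : 1 <= rint (- s) s (fun t => cIm (mkc t (- s))^-1).
  apply: (cst _ (cts_Im h1)) => t ts.
  rewrite invc_mkc /cIm /cRe /= mulNr opprK sqrrN; exact: low.
have H2 : rint (- s) s (fun t => cIm (mkc t s)^-1) <= -1.
  apply: (cstN _ (cts_Im h2)) => t ts; rewrite invc_mkc /cIm /cRe /= lerN2; exact: low.
have H3 : 1 <= rint (- s) s (fun t => cRe (mkc s t)^-1).
  apply: (cst _ (cts_Re v2)) => t ts.
  rewrite invc_mkc /cIm /cRe /= [_ + t ^+ 2]addrC; exact: low.
have H4 : rint (- s) s (fun t => cRe (mkc (- s) t)^-1) <= -1.
  apply: (cstN _ (cts_Re v1)) => t ts.
  rewrite invc_mkc /cIm /cRe /=.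
  by rewrite sqrrN mulNr lerN2 [_ + t ^+ 2]addrC; exact: low.
lra.
Qed.

(** A primitive is -z^(-k) / k. Hence only the term 1/z survives when the kernel is expanded against
    the constant function 1. *)
Lemma Sq_expV k : (0 < k)%N -> Sq (fun z => (z ^+ k.+1)^-1) = 0.
Proof.
move=> k0; apply: (@Phi_prim _ _ (fun z => - k%:R^-1 * (z ^+ k)^-1)) => //.
  exact: bdder_cont (@bdder_expV _).
move=> z /(rbd_neq0 s0) z0.
have kn : (k%:R : C) != 0 by rewrite pnatr_eq0 -lt0n.
have := cderivZ (- k%:R^-1) (@cderivV _ (fun z => z ^+ k) z _ (expf_neq0 k z0) (cderivX k z)).
suff -> : - k%:R^-1 * (- (k%:R * z ^+ k.-1) / z ^+ k ^+ 2) = (z ^+ k.+1)^-1 by [].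
case: k k0 kn => // k _; rewrite [k.+1.-1]/= !exprS; move: (k.+1%:R : C) => N N0.
by field; rewrite N0 z0 expf_neq0.
Qed.

(** Iteration of 1/(z - w) = 1/z + w / (z (z - w)): a finite and exact expansion of Cauchy's kernel,
    with no convergence involved. *)
Lemma Sq_geometric f n w : bdder s f -> cnorm w <= s / 2 ->
  Sq (fun z => f z * (z - w)^-1) =
  \sum_(k < n) w ^+ k * Sq (fun z => f z * (z ^+ k.+1)^-1) +
  w ^+ n * Sq (fun z => f z * (z ^+ n)^-1 * (z - w)^-1).
Proof.
move=> df ws; have dw := bdder_subV ws.
elim: n => [|n ->].
  rewrite big_ord0 add0r [w ^+ 0]expr0 [1 * Phi _ _ _ _ _]mul1r.
  by apply: Phi_ext => z _; rewrite expr0 invr1 mulr1.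
rewrite big_ord_recr /= -addrA; congr (_ + _).
rewrite exprSr -mulrA -mulrDr; congr (_ * _).
have d1 := bdderM df (@bdder_expV n.+1).
rewrite -PhiZ; last exact: bdder_cont (bdderM d1 dw).
rewrite -PhiD; last 2 first.
- exact: bdder_cont d1.
- apply: bdder_cont; apply: bdderM (bdderM d1 dw).
  by move=> z _; exists 0; exact: cderiv_cst.
apply: Phi_ext => z zb; have z0 := rbd_neq0 s0 zb.
have zw : z - w != 0.
  by apply: norm_neq0; exact: lt_le_trans s2 (rbd_sub s0 ws zb).
by rewrite exprSr; field; rewrite z0 zw expf_neq0.
Qed.

(** On the contour |z| >= s and |z - w| >= s / 2; the constant is 32 = 4 (from [Phi_norm]) times 4 s
    (side sum) times 2 / s. *)
Lemma Sq_remainder f n w M : bdder s f -> cnorm w <= s / 2 ->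
  (forall z, rbd (- s) s (- s) s z -> cnorm (f z) <= M) ->
  cnorm (w ^+ n * Sq (fun z => f z * (z ^+ n)^-1 * (z - w)^-1)) <=
  32 * M * (cnorm w / s) ^+ n.
Proof.
move=> df ws fM; have sn : s != 0 by rewrite gt_eqF.
have M0 : 0 <= M.
  apply: le_trans (cnorm_ge0 _) (fM (mkc s s) _).
  by constructor 2; exists s => //; rewrite sN lexx.
rewrite cnormM cnormX expr_div_n.
have H : cnorm (Sq (fun z => f z * (z ^+ n)^-1 * (z - w)^-1)) <=
    4 * (M * (s ^+ n)^-1 * (s / 2)^-1) * ((s - - s) + (s - - s)).
  apply: Phi_norm => //.
    exact: bdder_cont (bdderM (bdderM df (@bdder_expV n)) (bdder_subV ws)).
  move=> z zb; rewrite !cnormM !cnormV cnormX.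
  have z1 := rbd_norm s0 zb; have z2 := rbd_sub s0 ws zb.
  apply: ler_pM; rewrite ?mulr_ge0 ?invr_ge0 ?exprn_ge0 ?cnorm_ge0//.
    apply: ler_pM; rewrite ?invr_ge0 ?exprn_ge0 ?cnorm_ge0 ?fM//.
    rewrite lef_pV2 ?posrE ?exprn_gt0//; last exact: lt_le_trans z1.
    by rewrite lerXn2r// nnegrE ?cnorm_ge0// ltW.
  by rewrite lef_pV2 ?posrE//; exact: lt_le_trans z2.
apply: le_trans (ler_wpM2l (exprn_ge0 _ (cnorm_ge0 _)) H) _.
rewrite le_eqVlt; apply/orP; left; apply/eqP; field.
by rewrite sn expf_neq0.
Qed.

(** The quotient (f z - f w) / (z - w) is bounded near w by 1 + |f'(w)| and differentiable
    elsewhere, so [Goursat_punctured] applies. The factor [1 *] makes the right side an instance of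
    [Sq_geometric], so the integral of 1/(z - w) never has to be evaluated. *)
Lemma Cauchy_formula f w : cnorm w <= s / 2 ->
  (forall z, rect (- s) s (- s) s z -> exists l, cderiv f z l) ->
  Sq (fun z => f z * (z - w)^-1) = f w * Sq (fun z => 1 * (z - w)^-1).
Proof.
move=> ws df; have dw := bdder_subV ws; move: (s0) => sp.
have bf : bdder s f by move=> z /rbd_rect rz; apply: df; exact: rz.
have b1 : bdder s (fun z => 1) by move=> z _; exists 0; exact: cderiv_cst.
have [/ler_normlP[w1 w2] /ler_normlP[w3 w4]] := (le_trans (cRe_le w) ws, le_trans (cIm_le w) ws).
have rw : rect (- s) s (- s) s w by split; apply/andP; split; lra.
have [l dl] := df w rw.
apply/eqP; rewrite -subr_eq0 -PhiZ; last exact: bdder_cont (bdderM b1 dw).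
rewrite -PhiB; last 2 first.
- exact: bdder_cont (bdderM bf dw).
- apply: bdder_cont; apply: bdderM (bdderM b1 dw).
  by move=> z _; exists 0; exact: cderiv_cst.
have [e e0 He] := dl 1 ltr01.
apply/eqP; apply: (@Goursat_punctured _ _ _ _ _ _ (cRe w) (cIm w) (1 + cnorm l) e) => //.
- by apply/andP; split; lra.
- by apply/andP; split; lra.
- rewrite mkcE => z rz zw; have [m dm] := df z rz.
  eexists; apply: cderivB.
    apply: cderivM dm _; apply: (@cderivV _ (fun z => z - w)); first by rewrite subr_eq0.
    by apply: cderivB; [exact: cderiv_id|exact: cderiv_cst].
  apply: cderivZ; apply: cderivZ; apply: (@cderivV _ (fun z => z - w)).
    by rewrite subr_eq0.
  by apply: cderivB; [exact: cderiv_id|exact: cderiv_cst].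
- rewrite mkcE => z ze zw; rewrite mul1r -mulrBl cnormM cnormV.
  have zw0 : 0 < cnorm (z - w) by rewrite cnorm_gt0 subr_eq0.
  rewrite ler_pdivrMr//; have := He _ ze; rewrite subrKC.
  have := cnormD (f z - f w - l * (z - w)) (l * (z - w)); rewrite subrK cnormM.
  by move=> h1 h2; rewrite mulrDl; apply: le_trans h1 _; rewrite lerD2r.
Qed.

End Square.

Theorem holo_ps f (e : R) : 0 < e ->
  (forall z, cnorm z < e -> exists l, cderiv f z l) -> exists a, ps a f.
Proof.
(* Points of the square lie within 4 s = e / 2 of the origin, by the crude bound of [rect_dist]. *)
move=> e0 df; pose s := e / 8; have s0 : 0 < s by rewrite divr_gt0.
have sN : - s <= s by lra.
have {}df z : rect (- s) s (- s) s z -> exists l, cderiv f z l.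
  move=> rz; apply: df; rewrite -[z]subr0.
  have r0 : rect (- s) s (- s) s (0 : C) by split; rewrite /= oppr_le0 ltW.
  by apply: le_lt_trans (rect_dist rz r0) _; rewrite /s; lra.
have bf : bdder s f by move=> z /rbd_rect rz; apply: df; exact: rz.
have b1 : bdder s (fun z => 1) by move=> z _; exists 0; exact: cderiv_cst.
have [M M0 HM] : exists2 M, 0 <= M & forall z, rect (- s) s (- s) s z -> cnorm (f z) <= M.
  by apply: rect_bounded => // z /df [l]; exact: cderiv_cont.
have MM : 0 <= 64 * M by lra.
pose K := Phi (fun z => z^-1) (- s) s (- s) s.
have K0 : K != 0 := Sq_inv_neq0 s0.
have Kn : 0 < cnorm K by rewrite cnorm_gt0.
have nK : cnorm K <= 16.
  have -> : 16 = 4 * s^-1 * ((s - - s) + (s - - s)) by field; rewrite gt_eqF.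
  apply: Phi_norm => //.
    by have := bdder_cont (@bdder_expV _ s0 1).
  move=> z zb; have z1 := rbd_norm s0 zb.
  by rewrite cnormV lef_pV2 ?posrE//; exact: lt_le_trans z1.
(* Cauchy's coefficients with [K] in place of 2 pi i. The scale [2 / s] encodes |w| <= s / 2, and 64
   M is the sum of two remainders of size 32 M. *)
exists (fun k => Phi (fun z => f z * (z ^+ k.+1)^-1) (- s) s (- s) s / K).
exists (64 * M / cnorm K); exists (2 / s); first by split; rewrite ?divr_gt0// divr_ge0 // ltW.
move=> n w; rewrite mulrAC ler_pdivrMr// mul1r => ws2.
have ws : cnorm w <= s / 2 by lra.
have [/ler_normlP[w1 w2] /ler_normlP[w3 w4]] := (le_trans (cRe_le w) ws, le_trans (cIm_le w) ws).
have fw : cnorm (f w) <= M by apply: HM; split; apply/andP; split; lra.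
rewrite -(ler_pM2r Kn) -cnormM mulrBl mulr_suml.
have -> : \sum_(k < n) Phi (fun z => f z * (z ^+ k.+1)^-1) (- s) s (- s) s / K * w ^+ k * K =
   \sum_(k < n) w ^+ k * Phi (fun z => f z * (z ^+ k.+1)^-1) (- s) s (- s) s.
  by apply: eq_bigr => k _; field.
have -> : 64 * M / cnorm K * (2 * cnorm w / s) ^+ n * cnorm K = 64 * M * (2 * cnorm w / s) ^+ n.
  by field; rewrite gt_eqF.
case: n => [|n].
  rewrite big_ord0 subr0 expr0 mulr1 cnormM.
  have := ler_pM (cnorm_ge0 _) (cnorm_ge0 _) fw nK; lra.
(* For the constant 1 the expansion reduces to [K] plus a remainder. Substituted in Cauchy's
   formula, it leaves f(w) K minus the partial sum equal to a difference of two remainders. *)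
have E1 := Sq_geometric s0 n.+1 b1 ws.
rewrite big_ord_recl [w ^+ ord0]expr0 [1 * Phi _ _ _ _ _]mul1r big1 in E1; last first.
  move=> k _; rewrite (@Phi_ext _ _ (fun z => (z ^+ (lift ord0 k).+1)^-1)).
    by rewrite Sq_expV// mulr0.
  by move=> z _; exact: mul1r.
have EK : Phi (fun z => 1 * (z ^+ (ord0 : 'I_n.+1).+1)^-1) (- s) s (- s) s = K.
  by apply: Phi_ext => z _; exact: mul1r.
rewrite addr0 EK in E1.
have E := Cauchy_formula s0 ws df.
rewrite (Sq_geometric s0 n.+1 bf ws) E1 [f w * (K + _)]mulrDr in E.
have R1 := Sq_remainder s0 n.+1 bf ws (fun z zb => HM z (rbd_rect sN sN zb)).
have R2 : cnorm (w ^+ n.+1 * Phi (fun z => 1 * (z ^+ n.+1)^-1 * (z - w)^-1) (- s) s (- s) s)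
    <= 32 * 1 * (cnorm w / s) ^+ n.+1.
  by apply: Sq_remainder => // z _; rewrite cnorm1.
move: E R1 R2; set S := \sum_(k < _) _; set A := _ * Phi _ _ _ _ _; set B := _ * Phi _ _ _ _ _.
move=> E R1 R2.
have -> : f w * K - S = A - f w * B.
  have -> : f w * K = S + A - f w * B by rewrite E addrK.
  by rewrite addrAC (addrAC S) subrr add0r.
apply: le_trans (cnormB _ _) _; rewrite cnormM.
have P0 : 0 <= (cnorm w / s) ^+ n.+1 by rewrite exprn_ge0// divr_ge0 ?cnorm_ge0// ltW.
have P1 : (cnorm w / s) ^+ n.+1 <= (2 * cnorm w / s) ^+ n.+1.
  have q0 : 0 <= cnorm w / s by rewrite divr_ge0 ?cnorm_ge0// ltW.
  by rewrite lerXn2r ?nnegrE// -mulrA; lra.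
have R3 := ler_pM (cnorm_ge0 _) (cnorm_ge0 _) fw R2.
apply: le_trans (ler_wpM2l MM P1).
lra.
Qed.

End Cauchy.

(** * Power series *)

Section PowerSeries.
Variable R : realType.
Local Notation C := (Cx R).
Implicit Types (K s e : R) (f g : C -> C) (z w : C) (a b : nat -> C).

(** [ps] with its constants exposed, so that two series can be given common ones. *)
Definition psb K s a f := [/\ 0 <= K, 0 < s &
  forall n z, s * cnorm z <= 1 ->
    cnorm (f z - \sum_(k < n) a k * z ^+ k) <= K * (s * cnorm z) ^+ n].

Lemma psP a f : ps a f <-> exists K s, psb K s a f.
Proof.
split=> [[K [s [K0 s0] H]]|[K [s [K0 s0 H]]]]; first by exists K, s.
by exists K, s.
Qed.

Lemma psb_mono K s K' s' a f : K <= K' -> s <= s' -> psb K s a f -> psb K' s' a f.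
Proof.
move=> KK ss [K0 s0 H]; split; [exact: le_trans KK|exact: lt_le_trans ss|].
move=> n z z1; have z0 := cnorm_ge0 z.
have zz : s * cnorm z <= s' * cnorm z by rewrite ler_wpM2r.
apply: le_trans (H n z (le_trans zz z1)) _.
have x0 : 0 <= s * cnorm z by rewrite mulr_ge0// ltW.
apply: ler_pM => //; first exact: exprn_ge0.
by rewrite lerXn2r// nnegrE (le_trans x0).
Qed.

Lemma ps_pair a b f g : ps a f -> ps b g -> exists K s, psb K s a f /\ psb K s b g.
Proof.
move=> /psP[K [s H]] /psP[K' [s' H']].
have [K0 s0 _] := H; have [K0' s0' _] := H'.
by exists (K + K'), (s + s'); split; [apply: psb_mono H|apply: psb_mono H']; lra.
Qed.

(** At |z| = 1/s the remainders of orders n and n+1 are both at most K, and they differ by a_n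
    z^n. *)
Lemma psb_coef K s a f n : psb K s a f -> cnorm (a n) <= 2 * K * s ^+ n.
Proof.
move=> [K0 s0 H]; pose z := cof s^-1 : C.
have nz : cnorm z = s^-1 by rewrite cnorm_cof ger0_norm// invr_ge0 ltW.
have sz : s * cnorm z = 1 by rewrite nz mulfV// gt_eqF.
have := H n z; have := H n.+1 z; rewrite !sz lexx !expr1n mulr1 big_ord_recr/=.
move=> /(_ isT) H1 /(_ isT) H2.
have : cnorm (a n * z ^+ n) <= 2 * K.
  set S := \sum_(k < n) _ in H1 H2.
  have -> : a n * z ^+ n = (f z - S) - (f z - (S + a n * z ^+ n)) by ring.
  by have := cnormB (f z - S) (f z - (S + a n * z ^+ n)); lra.
by rewrite cnormM cnormX nz exprVn ler_pdivrMr// exprn_gt0.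
Qed.

Lemma ps_at0 a f : ps a f -> f 0 = a 0%N.
Proof.
move=> /psP[K [s [K0 s0 H]]]; have := H 1%N 0.
rewrite cnorm0 mulr0 ler01 expr1 mulr0 big_ord1 expr0 mulr1 => /(_ isT) h.
by apply/eqP; rewrite -subr_eq0 -cnorm_eq0 eq_le h cnorm_ge0.
Qed.

Lemma le_eps0 (x M : R) : 0 <= x -> (forall t, 0 < t < 1 -> x <= M * t) -> x = 0.
Proof.
move=> x0 H; apply/eqP; rewrite eq_le x0 andbT leNgt; apply/negP => xp.
have M0 : 0 < M.
  have h1 : 0 < 1 / 2 :> R by lra.
  have h2 : 1 / 2 < 1 :> R by lra.
  by have := H _ (introT andP (conj h1 h2)); lra.
pose t := Num.min (1 / 2) (x / (2 * M)).
have t0 : 0 < t by rewrite lt_min !divr_gt0// mulr_gt0.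
have t1 : t < 1 by rewrite gt_min; apply/orP; left; lra.
have := H t; rewrite t0 t1 => /(_ isT).
have : t <= x / (2 * M) by rewrite ge_min lexx orbT.
rewrite ler_pdivlMr ?mulr_gt0//; lra.
Qed.

(** If the coefficients below n agree, comparing remainders of order n+1 bounds |a_n - b_n| |z|^n by
    a multiple of |z|^(n+1); then z tends to 0. Only the punctured disc is used, as the solution
    matrix is known only there. *)
Lemma ps_uniq a b f g e : 0 < e -> ps a f -> ps b g ->
  (forall z, 0 < cnorm z < e -> f z = g z) -> forall n, a n = b n.
Proof.
move=> e0 fa gb fg; have [K [s [[K0 s0 H] [_ _ H']]]] := ps_pair fa gb.
move=> n; elim/ltn_ind: n => n IH.
apply/eqP; rewrite -subr_eq0 -cnorm_eq0; apply/eqP.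
pose r := Num.min (e / 2) (s^-1).
have r0 : 0 < r by rewrite lt_min divr_gt0// invr_gt0.
apply: (@le_eps0 _ (2 * K * s ^+ n.+1 * r)); first exact: cnorm_ge0.
move=> t /andP[t0 t1].
pose z := cof (t * r) : C.
have tr : 0 < t * r by rewrite mulr_gt0.
have nz : cnorm z = t * r by rewrite cnorm_cof gtr0_norm.
have re : r <= e / 2 by rewrite ge_min lexx.
have rs : r <= s^-1 by rewrite ge_min lexx orbT.
have trr : t * r < r by rewrite gtr_pMl.
have z1 : s * cnorm z <= 1.
  rewrite nz -ler_pdivlMl// mulr1; lra.
have E : f z = g z by apply: fg; rewrite nz tr/=; lra.
have := H n.+1 z z1; have := H' n.+1 z z1; rewrite !big_ord_recr /= E.
have -> : \sum_(k < n) a k * z ^+ k = \sum_(k < n) b k * z ^+ k.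
  by apply: eq_bigr => k _; rewrite IH.
set S := \sum_(k < n) _ => H1 H2.
have : cnorm ((a n - b n) * z ^+ n) <= 2 * K * (s * cnorm z) ^+ n.+1.
  have -> : (a n - b n) * z ^+ n = (g z - (S + b n * z ^+ n)) - (g z - (S + a n * z ^+ n)) by ring.
  by have := cnormB (g z - (S + b n * z ^+ n)) (g z - (S + a n * z ^+ n)); lra.
rewrite cnormM cnormX.
have -> : 2 * K * (s * cnorm z) ^+ n.+1 = (2 * K * s ^+ n.+1 * cnorm z) * cnorm z ^+ n.
  by rewrite exprMn [cnorm z ^+ n.+1]exprS; ring.
rewrite ler_pM2r; last by rewrite exprn_gt0// nz.
by rewrite nz (mulrC t) !mulrA.
Qed.

Lemma le_geo0 (x M : R) : 0 <= x -> (forall n, x * 2 ^+ n <= M) -> x = 0.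
Proof.
move=> x0 H; apply/eqP; rewrite eq_le x0 andbT leNgt; apply/negP => xp.
have [n] := exists_gt_expr2 (M / x).
by rewrite ltr_pdivrMr// mulrC ltNge H.
Qed.

(** On half the common radius both remainders are at most K / 2^n for every n. *)
Lemma ps_eq a f g : ps a f -> ps a g ->
  exists2 e, 0 < e & forall z, cnorm z < e -> f z = g z.
Proof.
move=> fa ga; have [K [s [[K0 s0 H] [_ _ H']]]] := ps_pair fa ga.
exists (2 * s)^-1; first by rewrite invr_gt0 mulr_gt0.
move=> z ze; apply/eqP; rewrite -subr_eq0 -cnorm_eq0; apply/eqP.
have x2 : s * cnorm z <= 2^-1.
  by move: ze; rewrite -[_^-1]mul1r ltr_pdivlMr ?mulr_gt0//; lra.
have x1 : s * cnorm z <= 1 by lra.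
apply: (@le_geo0 _ (2 * K)); first exact: cnorm_ge0.
move=> n; rewrite -ler_pdivlMr ?exprn_gt0//.
have := H n z x1; have := H' n z x1; set S := \sum_(k < n) _ => H1 H2.
have xn : (s * cnorm z) ^+ n <= 2^-1 ^+ n.
  by rewrite lerXn2r// nnegrE ?invr_ge0// mulr_ge0 ?cnorm_ge0// ltW.
have -> : f z - g z = (f z - S) - (g z - S) by ring.
have := cnormB (f z - S) (g z - S); rewrite -exprVn.
have := ler_wpM2l K0 xn; lra.
Qed.

Lemma eq_ps a b f : (forall n, a n = b n) -> ps a f -> ps b f.
Proof. by move=> ab; have -> : b = a by apply/funext => n; rewrite ab. Qed.

Lemma psD a b f g : ps a f -> ps b g -> ps (fun n => a n + b n) (fun z => f z + g z).
Proof.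
move=> fa gb; have [K [s [[K0 s0 H] [_ _ H']]]] := ps_pair fa gb.
apply/psP; exists (K + K), s; split => // [|n z z1]; first exact: addr_ge0.
have -> : \sum_(k < n) (a k + b k) * z ^+ k = \sum_(k < n) a k * z ^+ k + \sum_(k < n) b k * z ^+ k.
  by rewrite -big_split/=; apply: eq_bigr => k _; rewrite mulrDl.
rewrite opprD addrACA mulrDl; apply: le_trans (cnormD _ _) _.
by apply: lerD; [exact: H|exact: H'].
Qed.

Lemma psZ (c : C) a f : ps a f -> ps (fun n => c * a n) (fun z => c * f z).
Proof.
move=> /psP[K [s [K0 s0 H]]]; apply/psP; exists (cnorm c * K), s.
split => // [|n z z1]; first by rewrite mulr_ge0// cnorm_ge0.
have -> : \sum_(k < n) (c * a k) * z ^+ k = c * \sum_(k < n) a k * z ^+ k.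
  by rewrite mulr_sumr; apply: eq_bigr => k _; rewrite mulrA.
rewrite -mulrBr cnormM -mulrA ler_wpM2l ?cnorm_ge0//; exact: H.
Qed.

Lemma psB a b f g : ps a f -> ps b g -> ps (fun n => a n - b n) (fun z => f z - g z).
Proof.
move=> fa gb; have := psD fa (psZ (-1) gb).
have -> : (fun n => a n + -1 * b n) = (fun n => a n - b n).
  by apply/funext => n; rewrite mulN1r.
by have -> : (fun n => f n + -1 * g n) = (fun n => f n - g n)
  by apply/funext => n; rewrite mulN1r.
Qed.

Lemma ps_zero : ps (fun=> 0) (fun=> 0 : C).
Proof.
apply/psP; exists 0, 1; split => // n z _; rewrite mul0r sub0r cnormN.
by rewrite big1 ?cnorm0// => i _; rewrite mul0r.
Qed.

Lemma ps_one : ps (fun n => (n == 0%N)%:R) (fun=> 1 : C).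
Proof.
apply/psP; exists 1, 1; split => // -[|n] z; rewrite mul1r => z1.
  by rewrite big_ord0 subr0 cnorm1 expr0 mulr1.
rewrite big_ord_recl /= expr0 mulr1 big1 ?addr0 ?subrr ?cnorm0 ?mul1r ?exprn_ge0 ?cnorm_ge0//.
by move=> i _; rewrite mul0r.
Qed.

Definition shiftc a n := if n is m.+1 then a m else 0.

Lemma ps_mulX a f : ps a f -> ps (shiftc a) (fun z => z * f z).
Proof.
move=> /psP[K [s [K0 s0 H]]]; apply/psP; exists (K / s), s.
split => // [|n z z1]; first by rewrite divr_ge0// ltW.
have sn : s != 0 by rewrite gt_eqF.
have z0 := cnorm_ge0 z; have sz0 : 0 <= s * cnorm z by rewrite mulr_ge0// ltW.
case: n => [|n].
  rewrite big_ord0 subr0 expr0 mulr1 cnormM.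
  have := H 0%N z z1; rewrite big_ord0 subr0 expr0 mulr1 => h.
  rewrite ler_pdivlMr// mulrAC -[leRHS]mul1r (mulrC _ s); exact: ler_pM (cnorm_ge0 _) z1 h.
rewrite big_ord_recl /= mul0r add0r.
have -> : \sum_(i < n) a i * z ^+ bump 0 i = z * \sum_(i < n) a i * z ^+ i.
  by rewrite mulr_sumr; apply: eq_bigr => i _; rewrite /bump add1n exprS mulrCA.
rewrite -mulrBr cnormM exprS.
have -> : K / s * (s * cnorm z * (s * cnorm z) ^+ n) = cnorm z * (K * (s * cnorm z) ^+ n) by field.
by rewrite ler_wpM2l// H.
Qed.

Lemma ps_divX a f : ps a f -> a 0%N = 0 ->
  ps (fun n => a n.+1) (fun z => if z == 0 then a 1%N else f z / z).
Proof.
move=> fa a0; have f0 := ps_at0 fa; move/psP: fa => [K [s H]].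
have [K0 s0 Hb] := H.
(* [K * s] serves for z <> 0; [2 * K * s] bounds a_1, the value assigned at z = 0. *)
apply/psP; exists (K * s + 2 * K * s), s; split => //.
  by rewrite addr_ge0 ?mulr_ge0// ltW.
move=> n z z1; have sz0 : 0 <= s * cnorm z by rewrite mulr_ge0 ?cnorm_ge0// ltW.
have P0 : 0 <= (s * cnorm z) ^+ n by rewrite exprn_ge0.
have [->|zn0] := eqVneq z 0.
  rewrite cnorm0 mulr0; case: n {P0} => [|n].
    rewrite big_ord0 subr0 expr0 mulr1.
    by have := psb_coef 1 H; rewrite expr1; have := mulr_ge0 K0 (ltW s0); lra.
  rewrite big_ord_recl /= expr0 mulr1 big1 ?addr0 ?subrr ?cnorm0 ?expr0n/= ?mulr0//.
  by move=> i _; rewrite expr0n mulr0.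
have nz : 0 < cnorm z by rewrite cnorm_gt0.
have := Hb n.+1 z z1; rewrite big_ord_recl /= a0 mul0r add0r.
have -> : \sum_(i < n) a (bump 0 i) * z ^+ bump 0 i = z * \sum_(i < n) a i.+1 * z ^+ i.
  by rewrite mulr_sumr; apply: eq_bigr => i _; rewrite /bump add1n exprS mulrCA.
set S := \sum_(i < n) _.
have -> : f z - z * S = z * (f z / z - S) by field.
rewrite cnormM exprS.
have -> : K * (s * cnorm z * (s * cnorm z) ^+ n) = cnorm z * (K * s * (s * cnorm z) ^+ n) by ring.
rewrite ler_pM2l// => /le_trans; apply.
by rewrite ler_wpM2r// lerDl !mulr_ge0// ltW.
Qed.

Definition cconv a b n : C := \sum_(k < n.+1) a k * b (n - k)%N.

Lemma psM a b f g : ps a f -> ps b g -> ps (cconv a b) (fun z => f z * g z).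
Proof.
move=> fa gb; have [K [s [Ha Hb]]] := ps_pair fa gb.
have [K0 s0 H] := Ha; have [_ _ H'] := Hb.
apply/psP; exists (3 * K ^+ 2), (2 * s); split.
- by rewrite mulr_ge0// sqr_ge0.
- by rewrite mulr_gt0.
move=> n z z2; have z0 := cnorm_ge0 z; set x := s * cnorm z.
have x0 : 0 <= x by rewrite mulr_ge0// ltW.
have x1 : x <= 1 by move: z2; rewrite -mulrA -/x; lra.
pose rf n := f z - \sum_(k < n) a k * z ^+ k.
pose rg n := g z - \sum_(k < n) b k * z ^+ k.
have rfS m : rf m.+1 = rf m - a m * z ^+ m.
  by rewrite /rf big_ord_recr/= opprD addrA.
have rgS m : rg m.+1 = rg m - b m * z ^+ m.
  by rewrite /rg big_ord_recr/= opprD addrA.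
have rg0 : rg 0%N = g z by rewrite /rg big_ord0 subr0.
(* An exact formula for the remainder of the product, each of whose terms is of order |z|^m. *)
have E m : f z * g z - \sum_(k < m) cconv a b k * z ^+ k =
    \sum_(k < m) a k * z ^+ k * rg (m - k)%N + rf m * g z.
  elim: m => [|m IH]; first by rewrite !big_ord0 /rf big_ord0 !subr0 add0r.
  rewrite big_ord_recr/= opprD addrA IH rfS.
  have -> : \sum_(k < m.+1) a k * z ^+ k * rg (m.+1 - k)%N =
      \sum_(k < m.+1) a k * z ^+ k * rg (m - k)%N - cconv a b m * z ^+ m.
    rewrite /cconv mulr_suml -sumrB; apply: eq_bigr => k _.
    have km : (k <= m)%N by rewrite -ltnS.
    rewrite subSn// rgS mulrBr -[in z ^+ m](subnKC km) exprD; ring.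
  rewrite big_ord_recr/= subnn rg0; ring.
rewrite E; apply: le_trans (cnormD _ _) _; rewrite cnormM.
have B1 : cnorm (\sum_(k < n) a k * z ^+ k * rg (n - k)%N) <= n%:R * (2 * K ^+ 2 * x ^+ n).
  apply: le_trans (@cnorm_sum _ (fun k => a k * z ^+ k * rg (n - k)%N) n) _.
  have -> : n%:R * (2 * K ^+ 2 * x ^+ n) = \sum_(k < n) (2 * K ^+ 2 * x ^+ n).
    by rewrite sumr_const card_ord mulr_natl.
  apply: ler_sum => k _.
  have kn : (k <= n)%N by rewrite ltnW.
  rewrite !cnormM cnormX.
  have -> : 2 * K ^+ 2 * x ^+ n = (2 * K * s ^+ k * cnorm z ^+ k) * (K * x ^+ (n - k)).
    by rewrite -[in x ^+ n](subnKC kn) exprD {1}/x exprMn; ring.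
  apply: ler_pM; rewrite ?mulr_ge0 ?exprn_ge0 ?cnorm_ge0//; last exact: H'.
  by rewrite ler_wpM2r ?exprn_ge0// (psb_coef _ Ha).
have B2 : cnorm (rf n) * cnorm (g z) <= K * x ^+ n * K.
  apply: ler_pM; rewrite ?cnorm_ge0//; first exact: H.
  by have := H' 0%N z x1; rewrite big_ord0 subr0 expr0 mulr1.
have -> : 2 * s * cnorm z = 2 * x by rewrite /x mulrA.
rewrite exprMn.
(* The number of terms grows linearly in n; doubling the scale [s] absorbs it. *)
have n2 : n%:R * 2 + 1 <= 3 * 2 ^+ n :> R.
  rewrite -natrX -!natrM natr1 ler_nat.
  elim: n {E B1 B2} => // n IH; rewrite expnS; have : (0 < 2 ^ n)%N by rewrite expn_gt0.
  lia.
have P0 : 0 <= K ^+ 2 * x ^+ n by rewrite mulr_ge0 ?sqr_ge0 ?exprn_ge0.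
have := ler_wpM2r P0 n2.
move=> L; move: B2; have -> : K * x ^+ n * K = K ^+ 2 * x ^+ n by ring.
lra.
Qed.

End PowerSeries.

(** * Summing a series with geometrically bounded coefficients, and termwise differentiation *)

Section Summation.
Variable R : realType.
Local Notation C := (Cx R).
Implicit Types (K s e : R) (f g : C -> C) (z w : C) (a b : nat -> C).

Lemma geo_tail (u : nat -> R) K n m : (forall k, `|u (n + k)%N| <= K / 2 ^+ k) ->
  `|\sum_(k < n + m) u k - \sum_(k < n) u k| <= 2 * K - 2 * K / 2 ^+ m.
Proof.
move=> H; elim: m => [|m IH].
  by rewrite addn0 subrr normr0 expr0 divr1 subrr.
rewrite addnS big_ord_recr/= addrAC; apply: le_trans (ler_normD _ _) _.
have := H m; have -> : 2 * K / 2 ^+ m.+1 = K / 2 ^+ m.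
  by rewrite exprS; field; rewrite expf_neq0.
move: IH; rewrite -[2 * K / 2 ^+ m]mulrA; lra.
Qed.

(** The limit is the supremum of the lower bounds S_n - 2 K / 2^n. The tail constant [K'] may vary
    with n, so that for a power series the error inherits the factor (s |z|)^n. *)
Lemma geo_series_limit (u : nat -> R) K : (forall n, `|u n| <= K / 2 ^+ n) ->
  exists l : R, forall n K', (forall k, `|u (n + k)%N| <= K' / 2 ^+ k) ->
    `|l - \sum_(k < n) u k| <= 2 * K'.
Proof.
move=> H; pose S n := \sum_(k < n) u k.
have K0 : 0 <= K by have := H 0%N; rewrite expr0 divr1; apply: le_trans.
have tail n m : `|S (n + m)%N - S n| <= 2 * (K / 2 ^+ n).
  have Hn k : `|u (n + k)%N| <= (K / 2 ^+ n) / 2 ^+ k.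
    by apply: le_trans (H _) _; rewrite exprD invfM mulrA.
  apply: le_trans (geo_tail m Hn) _; rewrite lerBlDr lerDl.
  by rewrite !divr_ge0 ?mulr_ge0 ?divr_ge0 ?exprn_ge0.
have dist n m : S m - 2 * (K / 2 ^+ m) <= S n + 2 * (K / 2 ^+ n).
  have q0 i : 0 <= 2 * (K / 2 ^+ i) by rewrite mulr_ge0// divr_ge0// exprn_ge0.
  have [nm|/ltnW mn] := leqP n m.
    have := tail n (m - n)%N; rewrite subnKC// ler_norml => /andP[_].
    by have := q0 m; lra.
  have := tail m (n - m)%N; rewrite subnKC// ler_norml => /andP[+ _].
  by have := q0 n; lra.
pose E := [set S n - 2 * (K / 2 ^+ n) | n in setT].
exists (sup E).
have near n : `|sup E - S n| <= 2 * (K / 2 ^+ n).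
  rewrite ler_norml; apply/andP; split.
    rewrite lerBrDr addrC; apply: ub_le_sup; last by exists n.
    by exists (S 0%N + 2 * (K / 2 ^+ 0)) => _ [m _ <-].
  rewrite lerBlDr addrC; apply: ge_sup; first by exists (S 0%N - 2 * (K / 2 ^+ 0)); exists 0%N.
  by move=> _ [m _ <-].
move=> n K' Hn; apply/ler_addgt0Pr => x x0.
have [m0 Hm] := exists_gt_expr2 (2 * K / x).
have Hm' : 2 * (K / 2 ^+ (n + m0)) <= x.
  rewrite mulrA ler_pdivrMr ?exprn_gt0// [x * _]mulrC -ler_pdivrMr//.
  apply: le_trans (ltW Hm) _; rewrite exprD ler_peMl ?exprn_ge0//.
  by rewrite -natrX ler1n expn_gt0.
have K'0 : 0 <= K' by have := Hn 0%N; rewrite expr0 divr1; apply: le_trans.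
have t1 := geo_tail m0 Hn; have t2 := near (n + m0)%N.
have t3 : 0 <= 2 * K' / 2 ^+ m0 by rewrite divr_ge0 ?mulr_ge0 ?exprn_ge0.
have -> : sup E - \sum_(k < n) u k = (sup E - S (n + m0)%N) + (S (n + m0)%N - S n).
  by rewrite addrA subrK.
apply: le_trans (ler_normD _ _) _; rewrite /S in t2 *; lra.
Qed.

Lemma ps_sum K s a : 0 < s -> (forall n, cnorm (a n) <= K * s ^+ n) -> exists f, ps a f.
Proof.
move=> s0 aK; have K0 : 0 <= K.
  by have := aK 0%N; rewrite expr0 mulr1; apply: le_trans; exact: cnorm_ge0.
have term z : s * cnorm z <= 2^-1 -> forall n k,
    cnorm (a (n + k)%N * z ^+ (n + k)) <= K * (s * cnorm z) ^+ n / 2 ^+ k.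
  move=> z2 n k; rewrite cnormM cnormX.
  have x0 : 0 <= s * cnorm z by rewrite mulr_ge0 ?cnorm_ge0// ltW.
  apply: le_trans (_ : K * (s * cnorm z) ^+ (n + k) <= _).
    by rewrite exprMn mulrA ler_wpM2r ?exprn_ge0 ?cnorm_ge0.
  rewrite exprD mulrA ler_wpM2l ?mulr_ge0 ?exprn_ge0// -exprVn.
  by rewrite lerXn2r// nnegrE invr_ge0.
have cReS (u : nat -> C) n : cRe (\sum_(k < n) u k) = \sum_(k < n) cRe (u k).
  by elim: n => [|n IH]; rewrite ?big_ord0// !big_ord_recr/= cReD IH.
have cImS (u : nat -> C) n : cIm (\sum_(k < n) u k) = \sum_(k < n) cIm (u k).
  by elim: n => [|n IH]; rewrite ?big_ord0// !big_ord_recr/= cImD IH.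
have /choice[f fP] : forall z, exists l, s * cnorm z <= 2^-1 -> forall n,
    cnorm (l - \sum_(k < n) a k * z ^+ k) <= 4 * K * (s * cnorm z) ^+ n.
  move=> z; have [z2|z2] := leP (s * cnorm z) 2^-1; last by exists 0.
  have T := term z z2.
  have [l1 L1] : exists l : R, forall n K',
      (forall k, `|cRe (a (n + k)%N * z ^+ (n + k))| <= K' / 2 ^+ k) ->
    `|l - \sum_(k < n) cRe (a k * z ^+ k)| <= 2 * K'.
    apply: (@geo_series_limit (fun n => cRe (a n * z ^+ n)) K) => n.
    by apply: le_trans (cRe_le _) _; have := T 0%N n; rewrite add0n expr0 mulr1.
  have [l2 L2] : exists l : R, forall n K',
      (forall k, `|cIm (a (n + k)%N * z ^+ (n + k))| <= K' / 2 ^+ k) ->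
    `|l - \sum_(k < n) cIm (a k * z ^+ k)| <= 2 * K'.
    apply: (@geo_series_limit (fun n => cIm (a n * z ^+ n)) K) => n.
    by apply: le_trans (cIm_le _) _; have := T 0%N n; rewrite add0n expr0 mulr1.
  exists (mkc l1 l2) => _ n; apply: le_trans (cnorm_leReIm _) _.
  rewrite cReD cImD cReN cImN (cReS (fun k => a k * z ^+ k)) (cImS (fun k => a k * z ^+ k)).
  have := L1 n (K * (s * cnorm z) ^+ n) (fun k => le_trans (cRe_le _) (T n k)).
  have := L2 n (K * (s * cnorm z) ^+ n) (fun k => le_trans (cIm_le _) (T n k)).
  rewrite /=; lra.
(* 4 is 2 for the geometric tail times 2 for real and imaginary parts; [2 * s] restricts to the disc
   where the terms decay like 2^(-k). *)
exists f; apply/psP; exists (4 * K), (2 * s); split; [by rewrite mulr_ge0|by rewrite mulr_gt0|].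
move=> n z z1; have z2 : s * cnorm z <= 2^-1 by move: z1; rewrite -mulrA; lra.
apply: le_trans (fP z z2 n) _; apply: ler_wpM2l; first by rewrite mulr_ge0.
have x0 : 0 <= s * cnorm z by rewrite mulr_ge0 ?cnorm_ge0// ltW.
by rewrite -mulrA; move: x0; move: (s * cnorm z) => y y0; rewrite lerXn2r ?nnegrE//; lra.
Qed.

Definition derivc a n : C := n.+1%:R * a n.+1.

(** The remainder T_n obeys T_(n+1) = (z + h) T_n + n z^(n-1) h^2, and 4^n + n <= 4^(n+1) closes the
    induction. The factor [r ^+ 2] avoids the exponent n - 2. *)
Lemma expr_second_diff (z h : C) (r : R) n : 0 <= r -> cnorm z <= r -> cnorm (z + h) <= r ->
  cnorm ((z + h) ^+ n - z ^+ n - n%:R * z ^+ n.-1 * h) * r ^+ 2 <= cnorm h ^+ 2 * (4 * r) ^+ n.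
Proof.
move=> r0 zr zhr; elim: n => [|n IH].
  by rewrite !expr0 subrr mul0r mul0r subrr cnorm0 mul0r mulr1 sqr_ge0.
pose T m := (z + h) ^+ m - z ^+ m - m%:R * z ^+ m.-1 * h.
have -> : (z + h) ^+ n.+1 - z ^+ n.+1 - n.+1%:R * z ^+ n.+1.-1 * h =
    (z + h) * T n + n%:R * z ^+ n.-1 * h ^+ 2.
  rewrite /T -(natr1 n) /=; case: n {IH} => [|n]; first by rewrite !expr0 !expr1; ring.
  by rewrite /= !exprS; ring.
have A : cnorm ((z + h) * T n + n%:R * z ^+ n.-1 * h ^+ 2) <=
    r * cnorm (T n) + n%:R * r ^+ n.-1 * cnorm h ^+ 2.
  apply: le_trans (cnormD _ _) _; rewrite !cnormM !cnormX cnorm_nat; apply: lerD.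
    by rewrite ler_wpM2r ?cnorm_ge0.
  by rewrite ler_wpM2r ?sqr_ge0// ler_wpM2l// lerXn2r ?nnegrE ?cnorm_ge0.
apply: le_trans (ler_wpM2r (sqr_ge0 r) A) _.
rewrite mulrDl.
have -> : n%:R * r ^+ n.-1 * cnorm h ^+ 2 * r ^+ 2 = cnorm h ^+ 2 * r ^+ n.+1 * n%:R.
  case: n {IH A T} => [|n]; first by rewrite mul0r !mul0r mulr0.
  rewrite [n.+1.-1]/= [r ^+ n.+2]exprS [r ^+ n.+1]exprS; ring.
have -> : r * cnorm (T n) * r ^+ 2 = r * (cnorm (T n) * r ^+ 2) by rewrite mulrA.
apply: le_trans (lerD (ler_wpM2l r0 IH) (lexx _)) _.
have -> : r * (cnorm h ^+ 2 * (4 * r) ^+ n) = cnorm h ^+ 2 * r ^+ n.+1 * 4 ^+ n.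
  by rewrite exprMn [r ^+ n.+1]exprS; ring.
rewrite -mulrDr.
have -> : cnorm h ^+ 2 * (4 * r) ^+ n.+1 = cnorm h ^+ 2 * r ^+ n.+1 * 4 ^+ n.+1.
  by rewrite exprMn; ring.
rewrite ler_wpM2l// ?mulr_ge0 ?exprn_ge0 ?cnorm_ge0//.
rewrite -!natrX -natrD ler_nat expnS.
have : (n < 4 ^ n)%N by rewrite ltn_expl.
lia.
Qed.

Lemma sum_half_le n : \sum_(k < n) 2^-1 ^+ k <= 2 :> R.
Proof.
suff -> : \sum_(k < n) 2^-1 ^+ k = 2 - 2 * 2^-1 ^+ n :> R.
  by rewrite lerBlDr lerDl mulr_ge0// exprn_ge0// invr_ge0.
elim: n => [|n IH]; first by rewrite big_ord0 expr0 mulr1 subrr.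
by rewrite big_ord_recr/= IH exprS; field.
Qed.

Lemma ps_cderiv a f g : ps a f -> ps (derivc a) g ->
  exists2 e, 0 < e & forall z, cnorm z < e -> cderiv f z (g z).
Proof.
move=> fa ga; have [K [s [Ha Hb]]] := ps_pair fa ga.
have [K0 s0 H] := Ha; have [_ _ H'] := Hb.
(* With this radius 4 s r = 1/2, so the second-order remainders of the terms are dominated by a
   geometric series of ratio 1/2. *)
pose r := (8 * s)^-1; have r0 : 0 < r by rewrite invr_gt0 mulr_gt0.
have sr : s * r = 8^-1 by rewrite /r; field; rewrite gt_eqF.
exists r => // z zr.
(* 2 K from [psb_coef] times 2 from the geometric sum, over the [r ^+ 2] of [expr_second_diff]. *)
pose B := 4 * K / r ^+ 2.
have B0 : 0 <= B by rewrite divr_ge0 ?sqr_ge0 ?mulr_ge0.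
have main h : cnorm (z + h) <= r -> cnorm h <= 1 ->
    cnorm (f (z + h) - f z - g z * h) <= B * cnorm h ^+ 2.
  move=> zhr h1; apply/ler_addgt0Pr => x x0.
  have [n Hn] := exists_gt_expr2 (3 * K / x).
  have small w : cnorm w <= r -> s * cnorm w <= 8^-1.
    by move=> wr; rewrite -sr ler_wpM2l// ltW.
  have rem w m : cnorm w <= r -> K * (s * cnorm w) ^+ (m + n) <= K * 2^-1 ^+ n.
    move=> wr; have := small w wr => w8; rewrite ler_wpM2l//.
    have y0 : 0 <= s * cnorm w by rewrite mulr_ge0 ?cnorm_ge0// ltW.
    rewrite exprD -[leRHS]mul1r; apply: ler_pM; rewrite ?exprn_ge0//.
      by rewrite exprn_ile1//; lra.
    by rewrite lerXn2r ?nnegrE ?invr_ge0//; lra.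
  have r1 w : cnorm w <= r -> cnorm (f w - \sum_(k < n.+1) a k * w ^+ k) <= K * 2^-1 ^+ n.
    move=> wr; apply: le_trans (H _ _ _) (rem w 1%N wr).
    by have := small w wr; lra.
  have r2 : cnorm (g z - \sum_(k < n) derivc a k * z ^+ k) <= K * 2^-1 ^+ n.
    apply: le_trans (H' _ _ _) (rem z 0%N (ltW zr)).
    by have := small z (ltW zr); lra.
  have SE : \sum_(k < n.+1) a k * (z + h) ^+ k - \sum_(k < n.+1) a k * z ^+ k
      - (\sum_(k < n) derivc a k * z ^+ k) * h =
      \sum_(k < n.+1) a k * ((z + h) ^+ k - z ^+ k - k%:R * z ^+ k.-1 * h).
    have -> : (\sum_(k < n) derivc a k * z ^+ k) * h = \sum_(k < n.+1) a k * (k%:R * z ^+ k.-1 * h).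
      rewrite big_ord_recl /= mul0r mul0r mulr0 add0r mulr_suml; apply: eq_bigr => k _.
      by rewrite /derivc /bump add1n /=; ring.
    by rewrite -!sumrB; apply: eq_bigr => k _; ring.
  have r3 : cnorm (\sum_(k < n.+1) a k * ((z + h) ^+ k - z ^+ k - k%:R * z ^+ k.-1 * h))
      <= B * cnorm h ^+ 2.
    apply: le_trans (@cnorm_sum _
      (fun k => a k * ((z + h) ^+ k - z ^+ k - k%:R * z ^+ k.-1 * h)) _) _.
    apply: le_trans (_ : \sum_(k < n.+1) (2 * K / r ^+ 2 * cnorm h ^+ 2) * 2^-1 ^+ k <= _).
      apply: ler_sum => k _; rewrite cnormM.
      have D := expr_second_diff k (ltW r0) (ltW zr) zhr.
      rewrite -ler_pdivlMr ?exprn_gt0// in D.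
      apply: le_trans (ler_pM (cnorm_ge0 _) (cnorm_ge0 _) (psb_coef k Ha) D) _.
      have -> : 2 * K * s ^+ k * (cnorm h ^+ 2 * (4 * r) ^+ k / r ^+ 2) =
        2 * K / r ^+ 2 * cnorm h ^+ 2 * (4 * (s * r)) ^+ k.
        by rewrite !exprMn; ring.
      have -> : 4 * (s * r) = 2^-1 by rewrite sr; field.
      exact: lexx.
    rewrite -mulr_sumr.
    have P0 : 0 <= 2 * K / r ^+ 2 * cnorm h ^+ 2.
      by apply: mulr_ge0 (sqr_ge0 _); apply: divr_ge0 (sqr_ge0 _); exact: mulr_ge0.
    apply: le_trans (ler_wpM2l P0 (sum_half_le n.+1)) _.
    by rewrite /B; lra.
  have q1 := r1 _ zhr; have q2 := r1 _ (ltW zr).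
  move: SE q1 q2 r2 r3; set S1 := \sum_(k < n.+1) a k * (z + h) ^+ k.
  set S2 := \sum_(k < n.+1) a k * z ^+ k; set S3 := \sum_(k < n) _; set S4 := \sum_(k < n.+1) _.
  move=> SE q1 q2 r2 r3.
  have -> : f (z + h) - f z - g z * h = (f (z + h) - S1) - (f z - S2) - (g z - S3) * h + S4.
    by rewrite -SE; ring.
  have t1 := cnormD ((f (z + h) - S1) - (f z - S2) - (g z - S3) * h) S4.
  have t2 := cnormB ((f (z + h) - S1) - (f z - S2)) ((g z - S3) * h).
  have t3 := cnormB (f (z + h) - S1) (f z - S2).
  have t4 : cnorm ((g z - S3) * h) <= K * 2^-1 ^+ n.
    rewrite cnormM -[leRHS]mulr1; apply: ler_pM; rewrite ?cnorm_ge0//.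
  have t5 : 3 * (K * 2^-1 ^+ n) <= x.
    rewrite exprVn mulrA ler_pdivrMr ?exprn_gt0// [x * _]mulrC -ler_pdivrMr//; exact: ltW.
  lra.
move=> e e0; pose d := Num.min (Num.min 1 (r - cnorm z)) (e / (B + 1)).
have B1 : 0 < B + 1 by lra.
exists d; first by rewrite !lt_min ltr01 subr_gt0 zr divr_gt0.
move=> h; rewrite !lt_min => /andP[/andP[h1 h2] h3].
apply: le_trans (main h _ (ltW h1)) _.
  by have := cnormD z h; lra.
rewrite expr2 mulrA ler_wpM2r ?cnorm_ge0//.
move: h3; rewrite ltr_pdivlMr//; have := cnorm_ge0 h; lra.
Qed.

(** Since n + 1 <= 2^n, doubling [s] absorbs the factor created by differentiation, and [ps_sum]
    sums the derived series. *)
Lemma ps_cderiv_ex a f : ps a f -> exists2 g, ps (derivc a) g &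
  exists2 e, 0 < e & forall z, cnorm z < e -> cderiv f z (g z).
Proof.
move=> fa; have /psP[K [s H]] := fa; have [K0 s0 _] := H.
have [g gP] : exists g, ps (derivc a) g.
  apply: (@ps_sum (2 * K * s) (2 * s)); first by rewrite mulr_gt0.
  move=> n; rewrite /derivc cnormM cnorm_nat.
  have := psb_coef n.+1 H => Hn.
  apply: le_trans (ler_wpM2l (ler0n _ _) Hn) _.
  rewrite exprS exprMn.
  have -> : n.+1%:R * (2 * K * (s * s ^+ n)) = (2 * K * s * s ^+ n) * n.+1%:R by ring.
  have -> : 2 * K * s * (2 ^+ n * s ^+ n) = (2 * K * s * s ^+ n) * 2 ^+ n by ring.
  rewrite ler_wpM2l ?mulr_ge0 ?exprn_ge0 ?(ltW s0)//.
  by rewrite -natrX ler_nat ltn_expl.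
by exists g => //; exact: ps_cderiv fa gP.
Qed.

Lemma ps_neq0 a f : ps a f -> a 0%N = 0 -> a 1%N != 0 ->
  exists2 e, 0 < e & forall z, 0 < cnorm z < e -> f z != 0.
Proof.
move=> /psP[K [s [K0 s0 H]]] a0 a1; have n1 : 0 < cnorm (a 1%N) by rewrite cnorm_gt0.
pose L := K * s ^+ 2 + 1; have L0 : 0 < L by rewrite ltr_wpDl// mulr_ge0 ?sqr_ge0.
exists (Num.min s^-1 (cnorm (a 1%N) / L)); first by rewrite lt_min invr_gt0 s0 divr_gt0.
move=> z /andP[z0]; rewrite lt_min => /andP[zs]; rewrite ltr_pdivlMr// => zL.
apply/eqP => fz; have := H 2%N z.
rewrite -ler_pdivlMl// mulr1 (ltW zs) => /(_ isT).
rewrite !big_ord_recl big_ord0 /= a0 mul0r add0r addr0 fz sub0r cnormN cnormM /bump /= expr1.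
have -> : K * (s * cnorm z) ^+ 2 = (K * s ^+ 2 * cnorm z) * cnorm z by ring.
rewrite ler_pM2r// leNgt => /negP; apply.
apply: le_lt_trans zL; rewrite /L; lra.
Qed.

(** [ps_neq0] applied to z f(z), whose linear coefficient is a_0. *)
Lemma ps_continuous_neq0 a f : ps a f -> a 0%N != 0 ->
  exists2 e, 0 < e & forall z, cnorm z < e -> f z != 0.
Proof.
move=> fa a0; have f0 := ps_at0 fa.
have [e e0 He] := ps_neq0 (ps_mulX fa) erefl (a0 : shiftc a 1 != 0).
exists e => // z ze; have [->|zn] := eqVneq z 0; first by rewrite f0.
have := He z; rewrite cnorm_gt0 zn ze => /(_ isT).
by rewrite mulf_eq0 negb_or => /andP[].
Qed.

End Summation.

(** * The system at a simple zero *)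

Section Recurrence.
Variable R : realType.
Local Notation C := (Cx R).
Implicit Types (a b u v gam kap : nat -> C) (rho : C) (N n : nat).

(* Coefficient form of  z U' = (N + 1) U + rho K V  and  z V' = N V + rho z^2 G U,
   the system satisfied by U = z^(N+1) w_1 and V = z^N w_2 when r^2 = z^2 G = z^2 / K. *)
Definition rec_sys rho kap gam N u v :=
  (forall n, n%:R * u n = N.+1%:R * u n + rho * cconv kap v n) /\
  (forall n, n%:R * v n = N%:R * v n + rho * shiftc (shiftc (cconv gam u)) n).

Lemma cconv_eq0 a b n : (forall k, (k <= n)%N -> b k = 0) -> cconv a b n = 0.
Proof. by move=> H; rewrite /cconv big1// => k _; rewrite H ?mulr0 ?leq_subr. Qed.

Lemma shift2_cconv_eq0 a b n : (forall k, (k.+1 < n)%N -> b k = 0) ->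
  shiftc (shiftc (cconv a b)) n = 0.
Proof.
by case: n => [|[|n]] H //=; apply: cconv_eq0 => k kn; apply: H.
Qed.

Lemma natr_neq (n m : nat) : n != m -> (n%:R - m%:R : C) != 0.
Proof. by move=> nm; rewrite subr_eq0 eqr_nat. Qed.

(* At the resonant index N + 1 the first recurrence has no unknown, and forces
   kap_1 v_N = 0. *)
Lemma rec_sys_vanish rho kap gam N u v : rho != 0 -> kap 1%N != 0 ->
  rec_sys rho kap gam N u v -> u N.+1 = 0 -> forall n, u n = 0 /\ v n = 0.
Proof.
move=> rho0 k1 [R1 R2] uN n; elim/ltn_ind: n => n IH.
have E2 m : (m <= n.+1)%N -> m != N -> (forall k, (k.+1 < m)%N -> u k = 0) -> v m = 0.
  move=> mn mN low; have := R2 m; rewrite shift2_cconv_eq0// mulr0 addr0 => /eqP.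
  rewrite -subr_eq0 -mulrBl mulf_eq0 (negbTE (natr_neq mN)).
  by move/eqP.
have vn : v n = 0.
  have [nN|nN] := eqVneq n N; last first.
    by apply: E2 => // k kn; case: (IH k (ltnW kn)).
  (* The resonant equation also contains kap_0 v_(N+1), which must vanish before kap_1 v_N = 0 can
     be read off. *)
  have v1 : v n.+1 = 0.
    apply: E2 => //; first by rewrite nN gtn_eqF.
    by move=> k; rewrite ltnS => /IH [].
  have := R1 n.+1; rewrite -nN => /eqP.
  rewrite -subr_eq0 opprD addrA subrr sub0r oppr_eq0 mulf_eq0 (negbTE rho0) /=.
  rewrite /cconv !big_ord_recl big1 => [|k _]; last first.
    have -> : v (n.+1 - lift ord0 (lift ord0 k))%N = 0; last by rewrite mulr0.
    have -> : (n.+1 - lift ord0 (lift ord0 k) = n - k.+1)%N by rewrite /= /bump /=; lia.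
    have := ltn_ord k => kn.
    by have [] := IH (n - k.+1)%N; first by lia.
  rewrite subn0 v1 mulr0 add0r addr0 /= /bump /= subSS subn0.
  by rewrite mulf_eq0 (negbTE k1) /= => /eqP.
split => //; have [->//|nN] := eqVneq n N.+1.
have := R1 n; rewrite cconv_eq0 ?mulr0 ?addr0 => [/eqP|k].
  rewrite -subr_eq0 -mulrBl mulf_eq0 (negbTE (natr_neq nN)).
  by move/eqP.
by rewrite leq_eqVlt => /predU1P[->//|/IH []].
Qed.

Lemma cconv_lin a (u v : nat -> C) (x y : C) n :
  cconv a (fun k => x * u k + y * v k) n = x * cconv a u n + y * cconv a v n.
Proof.
rewrite /cconv !mulr_sumr -big_split/=; apply: eq_bigr => k _; ring.
Qed.

Lemma rec_sys_lin rho kap gam N u v u' v' (x y : C) :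
  rec_sys rho kap gam N u v -> rec_sys rho kap gam N u' v' ->
  rec_sys rho kap gam N (fun n => x * u n + y * u' n) (fun n => x * v n + y * v' n).
Proof.
move=> [A1 A2] [B1 B2]; split => n.
  rewrite cconv_lin mulrDr !(mulrCA n%:R) A1 B1; ring.
have -> : shiftc (shiftc (cconv gam (fun n => x * u n + y * u' n))) n =
   x * shiftc (shiftc (cconv gam u)) n + y * shiftc (shiftc (cconv gam u')) n.
  by case: n => [|[|n]] /=; rewrite ?cconv_lin//; ring.
rewrite mulrDr !(mulrCA n%:R) A2 B2; ring.
Qed.

(** Iterating [F] from 0 fixes the entry of index k after k + 1 rounds; the diagonal of the iterates
    is the fixed point. *)
Lemma strong_recursion (F : (nat -> C) -> nat -> C) :
  (forall n h h', (forall k, (k < n)%N -> h k = h' k) -> F h n = F h' n) ->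
  exists v, forall n, v n = F v n.
Proof.
move=> FP; pose S n := iter n F (fun=> 0).
have stable n : forall k, (k < n)%N -> S n.+1 k = S n k.
  elim: n => // n IH k kn; apply: (FP k (S n.+1) (S n)) => j jk.
  by apply: IH; exact: leq_trans jk kn.
have stable' n m k : (k < n)%N -> S (n + m)%N k = S n k.
  move=> kn; elim: m => [|m <-]; first by rewrite addn0.
  by rewrite addnS stable// ltn_addr.
exists (fun n => S n.+1 n) => n.
apply: (FP n (S n)) => k kn; rewrite -(subnKC kn); exact: stable'.
Qed.

(** As s <= L / 2, the k-th product is at most M B L^n / 2^k: the sum stays within a factor 2,
    independently of n. *)
Lemma cconv_bound a b (M s B L : R) n : 0 <= s -> 0 <= B -> 2 * s <= L ->
  (forall k, cnorm (a k) <= M * s ^+ k) ->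
  (forall k, (k <= n)%N -> cnorm (b k) <= B * L ^+ k) ->
  cnorm (cconv a b n) <= 2 * (M * B) * L ^+ n.
Proof.
move=> s0 B0 sL aM bB.
have M0 : 0 <= M by have := aM 0%N; rewrite expr0 mulr1; apply: le_trans; exact: cnorm_ge0.
have L0 : 0 <= L by apply: le_trans sL; rewrite mulr_ge0.
have P0 : 0 <= M * B * L ^+ n by rewrite !mulr_ge0// exprn_ge0.
apply: le_trans (@cnorm_sum _ (fun k => a k * b (n - k)%N) _) _.
apply: le_trans (_ : \sum_(k < n.+1) (M * B * L ^+ n) * 2^-1 ^+ k <= _); last first.
  by rewrite -mulr_sumr; have := ler_wpM2l P0 (sum_half_le R n.+1); lra.
apply: ler_sum => k _; have kn : (k <= n)%N by rewrite -ltnS.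
rewrite cnormM; apply: le_trans (ler_pM (cnorm_ge0 _) (cnorm_ge0 _) (aM k) (bB _ (leq_subr _ _))) _.
have -> : M * B * L ^+ n * 2^-1 ^+ k = (M * (L / 2) ^+ k) * (B * L ^+ (n - k)).
  by rewrite -[in L ^+ n](subnKC kn) exprD exprMn; ring.
apply: ler_wpM2r; first by rewrite mulr_ge0// exprn_ge0.
apply: ler_wpM2l => //; rewrite lerXn2r ?nnegrE//; lra.
Qed.

Lemma rec_sys_solution rho kap gam (M s : R) (al be : C) : 0 < s ->
  (forall n, cnorm (kap n) <= M * s ^+ n) -> (forall n, cnorm (gam n) <= M * s ^+ n) ->
  kap 1%N = 0 ->
  exists u v, [/\ rec_sys rho kap gam 0 u v, v 0%N = al, v 1%N = 0, u 1%N = be &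
    exists A L : R, [/\ 0 < L, forall n, cnorm (u n) <= A * L ^+ n &
      forall n, cnorm (v n) <= A * L ^+ n]].
Proof.
move=> s0 kM gM k1.
have M0 : 0 <= M by have := kM 0%N; rewrite expr0 mulr1; apply: le_trans; exact: cnorm_ge0.
(* u is eliminated in favour of v; at the resonant index 1 the divisor vanishes and [be] is
   inserted. As u_n needs v up to n and v_n needs u only up to n - 2, what is left is a recursion
   for v alone. *)
pose U v n : C := if n == 1%N then be else rho / (n%:R - 1) * cconv kap v n.
pose F v n : C := if n == 0%N then al else rho / n%:R * shiftc (shiftc (cconv gam (U v))) n.
have [v vP] : exists v, forall n, v n = F v n.
  apply: strong_recursion => n h h' hh; rewrite /F; case: (n == 0%N) => //.
  congr (_ * _); case: n hh => [|[|n]] //= hh.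
  rewrite /cconv; apply: eq_bigr => k _; congr (_ * _); rewrite /U.
  case: (_ == 1%N) => //; congr (_ * _); apply: eq_bigr => j _; congr (_ * _).
  by apply: hh; lia.
have v0 : v 0%N = al by rewrite vP.
have v1 : v 1%N = 0 by rewrite vP /F /= mulr0.
have natN1 n : n != 1%N -> (n%:R - 1 : C) != 0 by exact: (@natr_neq n 1).
exists (U v), v; split => //.
  split=> n.
    have [->|n1] := eqVneq n 1%N.
      rewrite /cconv !big_ord_recl big_ord0 /= /bump /= subn0 v1 k1 /=; ring.
    apply/eqP; rewrite -subr_eq0 opprD addrA -mulrBl subr_eq0; apply/eqP.
    rewrite {1}/U (negbTE n1) mulrA; congr (_ * _); field; exact: natN1.
  have [->|n0] := eqVneq n 0%N; first by rewrite /= !mul0r mulr0 add0r.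
  rewrite {1}vP /F (negbTE n0) mul0r add0r; field.
  by rewrite pnatr_eq0.
pose B := cnorm al + 1.
have B1 : 1 <= B by rewrite /B lerDr cnorm_ge0.
have B0 : 0 <= B by lra.
pose A := cnorm be + cnorm rho * (2 * (M * B)).
have A0 : 0 <= A by rewrite /A addr_ge0 ?cnorm_ge0// !mulr_ge0// cnorm_ge0.
pose D := cnorm rho * (2 * (M * A)).
have D0 : 0 <= D by rewrite /D !mulr_ge0// cnorm_ge0.
(* [2 * s] is what [cconv_bound] requires. The summand [D] suffices because v_(n+2) depends on
   indices up to n, leaving two spare powers of [L]. *)
pose L := 1 + 2 * s + D.
have L1 : 1 <= L by rewrite /L; lra.
have L0 : 0 <= L by lra.
have sL : 2 * s <= L by rewrite /L; lra.
have Lexp n : 1 <= L ^+ n by rewrite exprn_ege1.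
have UB n : (forall k, (k <= n)%N -> cnorm (v k) <= B * L ^+ k) -> cnorm (U v n) <= A * L ^+ n.
  move=> H; rewrite /U; case: eqVneq => [_|n1].
    rewrite -[leLHS]mulr1; apply: ler_pM; rewrite ?cnorm_ge0//.
    by rewrite /A lerDl !mulr_ge0// cnorm_ge0.
  rewrite cnormM cnormM cnormV.
  have q : (cnorm (n%:R - 1 : C))^-1 <= 1.
    rewrite invf_le1 ?cnorm_gt0 ?natN1//.
    case: n n1 {H} => [|[|n]] // _; first by rewrite sub0r cnormN cnorm1.
    have -> : n.+2%:R - 1 = n.+1%:R :> C by rewrite -(natr1 n.+1) addrK.
    by rewrite cnorm_nat ler1n.
  apply: le_trans (_ : cnorm rho * 1 * (2 * (M * B) * L ^+ n) <= _).
    apply: ler_pM; rewrite ?mulr_ge0 ?invr_ge0 ?cnorm_ge0//.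
      by rewrite ler_wpM2l// cnorm_ge0.
    exact: (cconv_bound (ltW s0)).
  by rewrite mulr1 mulrA ler_wpM2r ?exprn_ge0// /A lerDr cnorm_ge0.
have VB n : cnorm (v n) <= B * L ^+ n.
  elim/ltn_ind: n => -[|[|n]] IH.
  - by rewrite v0 expr0 mulr1 /B lerDl.
  - by rewrite v1 cnorm0 mulr_ge0// exprn_ge0.
  rewrite vP /F /= !cnormM cnormV cnorm_nat.
  have q : (n.+2%:R)^-1 <= 1 :> R by rewrite invf_le1 ?ltr0n// ler1n.
  apply: le_trans (_ : cnorm rho * 1 * (2 * (M * A) * L ^+ n) <= _).
    apply: ler_pM; rewrite ?mulr_ge0 ?invr_ge0 ?cnorm_ge0//.
      by rewrite ler_wpM2l// cnorm_ge0.
    apply: (cconv_bound (ltW s0)) => // k kn; apply: UB => j jk; apply: IH; lia.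
  rewrite mulr1 mulrA -/D !exprS !mulrA ler_wpM2r ?exprn_ge0//.
  apply: le_trans (_ : L <= _); first by rewrite /L; lra.
  rewrite -[leLHS]mul1r; apply: ler_pM => //; rewrite -[leLHS]mul1r; exact: ler_pM.
exists (A + B), L; split; first lra.
  move=> n; apply: le_trans (UB n (fun k _ => VB k)) _.
  by rewrite ler_wpM2r ?exprn_ge0// lerDl.
move=> n; apply: le_trans (VB n) _.
by rewrite ler_wpM2r ?exprn_ge0// lerDr.
Qed.

End Recurrence.

(** * Passing between the differential system and its recurrences *)

Section SystemSeries.
Variable R : realType.
Local Notation C := (Cx R).
Implicit Types (u v gam kap phi : nat -> C) (rho : C) (N n : nat) (U V G K f : C -> C).

(** Pointwise and multiplied through by z, so that it can be asserted on a punctured disc for a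
    given solution and on a full disc for a constructed one. *)
Definition fun_sys rho K G N U V (z : C) := exists lU lV,
  [/\ cderiv U z lU, cderiv V z lV,
      z * lU = N.+1%:R * U z + rho * (K z * V z) &
      z * lV = N%:R * V z + rho * (z * (z * (G z * U z)))].

Lemma shift_derivc u n : shiftc (derivc u) n = n%:R * u n.
Proof. by case: n => [|n] //=; rewrite mul0r. Qed.

Lemma fun_sys_rec rho K G N U V kap gam u v (e : R) : 0 < e ->
  ps kap K -> ps gam G -> ps u U -> ps v V ->
  (forall z, 0 < cnorm z < e -> fun_sys rho K G N U V z) -> rec_sys rho kap gam N u v.
Proof.
move=> e0 pK pG pU pV H.
have [U' pU' [e1 e10 dU]] := ps_cderiv_ex pU.
have [V' pV' [e2 e20 dV]] := ps_cderiv_ex pV.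
pose d := Num.min e (Num.min e1 e2).
have d0 : 0 < d by rewrite !lt_min e0 e10.
have L z : 0 < cnorm z < d -> z * U' z = N.+1%:R * U z + rho * (K z * V z) /\
   z * V' z = N%:R * V z + rho * (z * (z * (G z * U z))).
  move=> /andP[z0]; rewrite !lt_min => /and3P[ze z1 z2].
  have [|lU [lV [dlU dlV E1 E2]]] := H z; first by rewrite z0.
  by rewrite (cderiv_unique (dU z z1) dlU) (cderiv_unique (dV z z2) dlV).
split => n; rewrite -shift_derivc.
  apply: (ps_uniq d0 (ps_mulX pU') (psD (psZ N.+1%:R pU) (psZ rho (psM pK pV)))).
  by move=> z /L [].
apply: (ps_uniq d0 (ps_mulX pV') (psD (psZ N%:R pV) (psZ rho (ps_mulX (ps_mulX (psM pG pU)))))).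
by move=> z /L [].
Qed.

Lemma rec_fun_sys rho K G N U V kap gam u v :
  ps kap K -> ps gam G -> ps u U -> ps v V -> rec_sys rho kap gam N u v ->
  exists2 e : R, 0 < e & forall z, cnorm z < e -> fun_sys rho K G N U V z.
Proof.
move=> pK pG pU pV [R1 R2].
have [U' pU' [e1 e10 dU]] := ps_cderiv_ex pU.
have [V' pV' [e2 e20 dV]] := ps_cderiv_ex pV.
have Q1 := ps_mulX pU'; have Q2 := ps_mulX pV'.
have [e3 e30 E3] : exists2 e : R, 0 < e & forall z, cnorm z < e ->
    z * U' z = N.+1%:R * U z + rho * (K z * V z).
  apply: (ps_eq Q1).
  apply: eq_ps (psD (psZ N.+1%:R pU) (psZ rho (psM pK pV))) => n.
  by rewrite shift_derivc R1.
have [e4 e40 E4] : exists2 e : R, 0 < e & forall z, cnorm z < e ->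
    z * V' z = N%:R * V z + rho * (z * (z * (G z * U z))).
  apply: (ps_eq Q2).
  apply: eq_ps (psD (psZ N%:R pV) (psZ rho (ps_mulX (ps_mulX (psM pG pU))))) => n.
  by rewrite shift_derivc R2.
exists (Num.min (Num.min e1 e2) (Num.min e3 e4)); first by rewrite !lt_min e10 e20 e30.
move=> z; rewrite !lt_min => /andP[/andP[z1 z2] /andP[z3 z4]].
by exists (U' z), (V' z); split; [exact: dU|exact: dV|exact: E3|exact: E4].
Qed.

Lemma simple_zero_data f phi : ps phi f -> phi 0%N = 0 -> phi 1%N != 0 ->
  exists K G kap gam (e : R), [/\ 0 < e, ps kap K, ps gam G,
    (kap 1%N = 0 <-> phi 2%N = 0) /\ kap 0%N != 0 &
    forall z, cnorm z < e -> f z ^+ 2 = z ^+ 2 * G z /\ G z * K z = 1].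
Proof.
move=> pf p0 p1; pose g z := if z == 0 then phi 1%N else f z / z.
have pg : ps (fun n => phi n.+1) g := ps_divX pf p0.
have [g' _ [e1 e10 dg]] := ps_cderiv_ex pg.
have [e2 e20 g0] := ps_continuous_neq0 pg p1.
pose G z := g z * g z; pose K z := (G z)^-1.
pose e := Num.min e1 e2; have e0 : 0 < e by rewrite lt_min e10.
have Gn0 z : cnorm z < e -> G z != 0.
  by rewrite lt_min => /andP[_ /g0 gz]; rewrite mulf_neq0.
(* The inverse is expanded by [holo_ps], as a differentiable function, rather than by inverting a
   series. *)
have [kap pK] : exists kap, ps kap K.
  apply: (@holo_ps _ _ e) => // z ze; have zn := Gn0 z ze.
  move: ze; rewrite lt_min => /andP[/dg dz _].
  by eexists; apply: cderivV zn _; exact: (cderivM dz dz).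
have pG := psM pg pg.
exists K, G, kap, (cconv (fun n => phi n.+1) (fun n => phi n.+1)), e.
have GK z : cnorm z < e -> G z * K z = 1 by move=> /Gn0 gz; rewrite mulfV.
(* The first two coefficients of G K = 1 read phi_1^2 k_0 = 1 and phi_1^2 k_1 + 2 phi_1 phi_2 k_0 =
   0, so k_1 and phi_2 vanish together. *)
have U1 := ps_uniq e0 (psM pG pK) (ps_one R) (fun z ze => GK z (andP ze).2).
have c0 := U1 0%N; have c1 := U1 1%N.
rewrite /cconv !big_ord_recl !big_ord0 /= /bump /= !subn0 !addr0 in c0 c1.
set k0 := kap 0%N in c0 c1 *; set k1 := kap 1%N in c0 c1 *.
set P1 := phi 1%N in c0 c1 p1 *; set P2 := phi 2%N in c0 c1 *.
have k00 : k0 != 0.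
  by apply/eqP => E; move: c0; rewrite E mulr0 => /eqP; rewrite eq_sym oner_eq0.
split => //.
  split => //; split => E.
    move: c1; rewrite E mulr0 add0r => /eqP; rewrite mulf_eq0 (negbTE k00) orbF.
    have -> : P1 * P2 + P2 * P1 = 2 * (P1 * P2) by ring.
    by rewrite !mulf_eq0 pnatr_eq0 (negbTE p1) /= => /eqP.
  move: c1; rewrite E mulr0 mul0r addr0 mul0r addr0 => /eqP.
  by rewrite mulf_eq0 mulf_eq0 (negbTE p1) /= => /eqP.
move=> z ze; split; last exact: GK.
rewrite /G /g; case: eqVneq => [->|z0]; first by rewrite (ps_at0 pf) p0 !expr0n !mul0r.
by field.
Qed.

End SystemSeries.

(** * Derivatives of matrix-valued functions by entries *)

Section MatrixDerivative.
Variable R : realType.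
Local Notation C := (Cx R).

Lemma is_derive_entry m n (W : C -> 'M[C]_(m, n)) (x : C) (D : 'M[C]_(m, n)) i j :
  is_derive x (1 : C) W D -> cderiv (fun y => W y i j) x (D i j).
Proof.
move=> [dW WD]; apply/cderivP.
have cW : (fun h : C => h^-1 *: ((W \o shift x) (h *: (1 : C)) - W x)) @ 0^' --> D.
  by rewrite -WD; exact: dW.
have H : (fun h : C => h^-1 *: (((fun y => W y i j) \o shift x) (h *: (1 : C))
    - W x i j)) @ 0^' --> D i j.
  have := cvg_comp _ _ cW (@coord_continuous C m n i j D).
  apply: cvg_trans; apply: near_eq_cvg; near=> h.
  by rewrite /= !mxE.
apply: DeriveDef; first by apply/cvg_ex; exists (D i j).
exact: cvg_lim H.
Unshelve. all: by end_near. Qed.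

Lemma is_derive_scale (V : normedModType C) (g : C -> C) (v : V) (x l : C) :
  cderiv g x l -> is_derive x (1 : C) (fun y => g y *: v) (l *: v).
Proof.
move=> /cderivP [dg gl].
have cg : (fun h : C => h^-1 *: ((g \o shift x) (h *: (1 : C)) - g x)) @ 0^' --> l.
  by rewrite -gl; exact: dg.
have H : (fun h : C => h^-1 *: (((fun y => g y *: v) \o shift x) (h *: (1 : C))
    - g x *: v)) @ 0^' --> l *: v.
  apply: cvg_trans (cvgZr_tmp (a := v) cg); apply: near_eq_cvg; near=> h.
  by rewrite /= -scalerBl scalerA.
apply: DeriveDef; first by apply/cvg_ex; exists (l *: v).
exact: cvg_lim H.
Unshelve. all: by end_near. Qed.

Lemma is_derive_matrix m n (W : C -> 'M[C]_(m.+1, n.+1)) (x : C) (D : 'M[C]_(m.+1, n.+1)) :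
  (forall i j, cderiv (fun y => W y i j) x (D i j)) -> is_derive x (1 : C) W D.
Proof.
move=> H.
have -> : W = \sum_(i < m.+1) \sum_(j < n.+1) (fun y => W y i j *: delta_mx i j).
  apply/funext => y; rewrite fct_sumE [LHS]matrix_sum_delta; apply: eq_bigr => i _.
  by rewrite fct_sumE.
rewrite [D]matrix_sum_delta; apply: is_derive_sum => i; apply: is_derive_sum => j.
exact: is_derive_scale.
Qed.

End MatrixDerivative.

(** * Sufficiency at a simple zero *)

Section StrongRegular.
Variable R : realType.
Local Notation C := (Cx R).
Implicit Types (r : C -> C) (rho : C).

Lemma sysA_mul r rho x (W : 'M[C]_2) (j : 'I_2) :
  (sysA r rho x *m W) ord0 j = rho * (r x ^+ 2)^-1 * W ord_max j /\
  (sysA r rho x *m W) ord_max j = rho * r x ^+ 2 * W ord0 j.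
Proof.
have E1 : lift ord0 ord0 = ord_max :> 'I_2 by apply/val_inj.
split; rewrite !mxE !big_ord_recl big_ord0 E1 !mxE /=; ring.
Qed.

Lemma ord2P (P : 'I_2 -> Prop) : P ord0 -> P ord_max -> forall i, P i.
Proof.
move=> P0 P1 [[|[|i]] Hi] //.
  by have -> : Ordinal Hi = ord0 by apply/val_inj.
by have -> : Ordinal Hi = ord_max by apply/val_inj.
Qed.

Lemma sub_norm_lt (x x0 : C) (e : R) : (`|x - x0| < cof e :> C) = (cnorm (x - x0) < e).
Proof. by rewrite normE lt_cof. Qed.

Lemma sub_norm_gt0 (x x0 : C) : (0 < `|x - x0| :> C) = (0 < cnorm (x - x0)).
Proof. by rewrite normE cof_gt0. Qed.

Lemma cderiv_center (f : C -> C) (x0 x l : C) :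
  cderiv f (x - x0) l -> cderiv (fun y => f (y - x0)) x l.
Proof.
move=> df; have := @cderiv_shift _ f (- x0) x l; rewrite addrC => /(_ df).
by apply: cderiv_near ltr01 _ => y _; rewrite addrC.
Qed.

Lemma unitmx2 (W : 'M[C]_2) :
  (W \in unitmx) = (W ord0 ord0 * W ord_max ord_max - W ord0 ord_max * W ord_max ord0 != 0).
Proof.
have E1 : lift ord0 ord0 = ord_max :> 'I_2 by apply/val_inj.
have E2 : lift ord_max ord0 = ord0 :> 'I_2 by apply/val_inj.
have E3 : 0 = ord0 :> 'I_1 by apply/val_inj.
rewrite unitmxE unitfE (expand_det_row _ ord0) !big_ord_recl big_ord0 /cofactor.
rewrite !det_mx11 !mxE !E3 !E1 !E2 /= expr0 expr1.
by congr (_ != _); ring.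
Qed.

Lemma zero_regular r (x0 : C) (phi : nat -> C) : ps phi (fun z => r (x0 + z)) ->
  phi 0%N = 0 -> phi 1%N != 0 -> phi 2%N = 0 ->
  forall rho, strong_regular (sysA r rho) x0.
Proof.
move=> pf p0 p1 p2 rho.
have [K [G [kap [gam [e0 [e00 pK pG [[_ k1] _] HGK]]]]]] := simple_zero_data pf p0 p1.
have {}k1 := k1 p2.
have [M [s [HK HG]]] := ps_pair pK pG.
have [M0 s0 _] := HK.
have kM n := psb_coef n HK; have gM n := psb_coef n HG.
(* The two columns take the free data (v_0, u_1) to be (1, 0) and (0, 1). *)
have [u1 [v1 [S1 v10 v11 u11 [A1 [L1 [L10 uB1 vB1]]]]]] := rec_sys_solution rho 1 0 s0 kM gM k1.
have [u2 [v2 [S2 v20 v21 u21 [A2 [L2 [L20 uB2 vB2]]]]]] := rec_sys_solution rho 0 1 s0 kM gM k1.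
have [U1 pU1] := ps_sum L10 uB1; have [V1 pV1] := ps_sum L10 vB1.
have [U2 pU2] := ps_sum L20 uB2; have [V2 pV2] := ps_sum L20 vB2.
have [e1 e10 F1] := rec_fun_sys pK pG pU1 pV1 S1.
have [e2 e20 F2] := rec_fun_sys pK pG pU2 pV2 S2.
have u20 : u2 0%N = 0.
  have [R1 _] := S2; have := R1 0%N.
  by rewrite /cconv big_ord1 subnn v20 !mulr0 addr0 mul0r mul1r.
(* Up to sign this is z times the determinant of the matrix built below. Its series starts 0 + 1 z,
   so it has no zero in a small punctured disc. *)
have [e3 e30 F3] : exists2 e : R, 0 < e &
    forall z, 0 < cnorm z < e -> U2 z * V1 z - U1 z * V2 z != 0.
  apply: (ps_neq0 (psB (psM pU2 pV1) (psM pU1 pV2))).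
    by rewrite /cconv !big_ord1 !subnn u20 v20 mul0r mulr0 subrr.
  rewrite /cconv !big_ord_recl !big_ord0 /= /bump /= !subn0 u20 u21 v10 v20 v21.
  by rewrite mul0r !mulr0 !addr0 add0r mulr1 subr0 oner_eq0.
pose e := Num.min (Num.min e0 e1) (Num.min e2 e3).
have ee : 0 < e by rewrite !lt_min e00 e10 e20.
pose UU (j : 'I_2) := if j == ord0 then U1 else U2.
pose VV (j : 'I_2) := if j == ord0 then V1 else V2.
have FF (j : 'I_2) z : cnorm z < e -> fun_sys rho K G 0 (UU j) (VV j) z.
  rewrite !lt_min => /andP[/andP[_ z1] /andP[z2 _]].
  by elim/ord2P: j; rewrite /UU /VV /=; [exact: F1|exact: F2].
pose W (x : C) : 'M[C]_2 :=
  \matrix_(i, j) if i == ord0 then UU j (x - x0) / (x - x0) else VV j (x - x0).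
pose H (x : C) : 'M[C]_2 :=
  \matrix_(i, j) if i == ord0 then UU j (x - x0) else (x - x0) * VV j (x - x0).
exists (cof e), W.
split; first by rewrite cof_gt0.
split.
  move=> x; rewrite sub_norm_lt sub_norm_gt0 => /andP[xz xe].
  have zn : x - x0 != 0 by rewrite -cnorm_gt0.
  have [f2 GK] : r x ^+ 2 = (x - x0) ^+ 2 * G (x - x0) /\ G (x - x0) * K (x - x0) = 1.
    have := HGK (x - x0); rewrite subrKC; apply.
    by move: xe; rewrite !lt_min => /andP[/andP[]].
  have Gn : G (x - x0) != 0.
    by apply/eqP => E; move/eqP: GK; rewrite E mul0r eq_sym oner_eq0.
  have KE : K (x - x0) = (G (x - x0))^-1 by rewrite -[RHS]mulr1 -GK mulKf.
  split.
    apply: is_derive_matrix => i j.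
    have [lU [lV [dU dV EU EV]]] := FF j (x - x0) xe.
    elim/ord2P: i.
      rewrite (sysA_mul r rho x _ j).1 !mxE /= f2.
      apply: cderiv_near ltr01 _ (_ : cderiv (fun y => UU j (y - x0) / (y - x0)) x _).
        by move=> y _; rewrite mxE.
      have dz : cderiv (fun y : C => y - x0) x 1.
        by have := cderivB (cderiv_id x) (cderiv_cst x0 x); rewrite subr0.
      have := cderivM (cderiv_center dU) (@cderivV _ (fun y : C => y - x0) x 1 zn dz).
      have -> : lU / (x - x0) + UU j (x - x0) * (- 1 / (x - x0) ^+ 2) =
          ((x - x0) * lU - UU j (x - x0)) / (x - x0) ^+ 2 by field.
      rewrite EU KE.
      suff -> : (1 * UU j (x - x0) + rho * ((G (x - x0))^-1 * VV j (x - x0))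
          - UU j (x - x0)) / (x - x0) ^+ 2
         = rho / ((x - x0) ^+ 2 * G (x - x0)) * VV j (x - x0) by [].
      by field; rewrite Gn zn.
    rewrite (sysA_mul r rho x _ j).2 !mxE /= f2.
    apply: cderiv_near ltr01 _ (_ : cderiv (fun y => VV j (y - x0)) x _).
      by move=> y _; rewrite mxE.
    suff <- : lV = rho * ((x - x0) ^+ 2 * G (x - x0)) * (UU j (x - x0) / (x - x0)).
      exact: cderiv_center.
    apply: (mulfI zn); rewrite EV mul0r add0r; field; exact: zn.
  have D0 : U2 (x - x0) * V1 (x - x0) - U1 (x - x0) * V2 (x - x0) != 0.
    by apply: F3; move: xe; rewrite !lt_min xz => /andP[_ /andP[]].
  rewrite unitmx2 !mxE /UU /VV /=; apply: contra D0 => /eqP E.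
  have -> : U2 (x - x0) * V1 (x - x0) - U1 (x - x0) * V2 (x - x0) =
      - (x - x0) * (U1 (x - x0) / (x - x0) * V2 (x - x0)
        - U2 (x - x0) / (x - x0) * V1 (x - x0)) by field.
  by rewrite E mulr0.
(* Only the first row U / z can have a pole, and it is simple; z times the matrix is holomorphic. *)
exists (-1), H.
split.
  move=> x; rewrite sub_norm_lt => xe.
  pose D : 'M[C]_2 := \matrix_(i, j) derive1 (fun y => H y i j) x.
  suff [] : is_derive x (1 : C) H D by [].
  apply: is_derive_matrix => i j; rewrite mxE.
  apply: derivable_cderiv.
  have [lU [lV [dU dV EU EV]]] := FF j (x - x0) xe.
  elim/ord2P: i.
    apply: cderiv_derivable.
    apply: cderiv_near ltr01 _ (cderiv_center dU).
    by move=> y _; rewrite mxE.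
  apply: cderiv_derivable.
  have dz : cderiv (fun y : C => y - x0) x 1.
    by have := cderivB (cderiv_id x) (cderiv_cst x0 x); rewrite subr0.
  apply: cderiv_near ltr01 _ (cderivM dz (cderiv_center dV)).
  by move=> y _; rewrite mxE.
move=> x; rewrite sub_norm_gt0 => /andP[xz _].
have zn : x - x0 != 0 by rewrite -cnorm_gt0.
apply/matrixP => i j; rewrite !mxE exprN1; case: (i == ord0); first by rewrite mulrC.
by rewrite mulKf.
Qed.

End StrongRegular.

(** * Necessity at a simple zero *)

Section Necessity.
Variable R : realType.
Local Notation C := (Cx R).

(** The integer exponent becomes a natural N clearing the pole: a nonnegative power of z is absorbed
    in the numerator with N = 0, a negative one gives N = -m. *)
Lemma laurent_numerator (W H : C -> 'M[C]_2) (x0 : C) (m : int) (e : R) :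
  holo_disc H x0 (cof e) ->
  (forall x, 0 < cnorm (x - x0) < e -> W x = (x - x0) ^ m *: H x) ->
  exists N (h : 'I_2 -> 'I_2 -> C -> C),
    (forall i j z, cnorm z < e -> exists l, cderiv (h i j) z l) /\
    (forall i j z, 0 < cnorm z < e -> h i j z = z ^+ N * W (x0 + z) i j).
Proof.
move=> hH WH.
have dH i j z : cnorm z < e -> exists l, cderiv (fun z => H (x0 + z) i j) z l.
  move=> ze; have := hH (x0 + z); rewrite addrAC subrr add0r normE lt_cof => /(_ ze) dH.
  eexists; apply: (@cderiv_shift _ (fun x => H x i j)); apply: is_derive_entry.
  exact: derivableP.
have {}WH i j z : 0 < cnorm z < e -> W (x0 + z) i j = z ^ m * H (x0 + z) i j.
  by have := WH (x0 + z); rewrite addrAC subrr add0r => /[apply] ->; rewrite mxE.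
case: m WH => p WH.
  exists 0%N, (fun i j z => z ^+ p * H (x0 + z) i j); split=> i j z ze.
    by have [l dl] := dH i j z ze; eexists; apply: cderivM dl; exact: cderivX.
  by rewrite WH// expr0 mul1r.
exists p.+1, (fun i j z => H (x0 + z) i j); split=> i j z ze; first exact: dH.
have z0 : z != 0 by case/andP: ze; rewrite cnorm_gt0.
by rewrite WH// NegzE -exprnN mulrA mulfV ?mul1r ?expf_neq0.
Qed.

Lemma regular_zero r (x0 : C) (phi : nat -> C) : ps phi (fun z => r (x0 + z)) ->
  phi 0%N = 0 -> phi 1%N != 0 -> strong_regular (sysA r 1) x0 -> phi 2%N = 0.
Proof.
move=> pf p0 p1 [e_ [W [e_0 [dW [m [H [hH WH]]]]]]].
have [e e0 ee] := gt0_cof e_0; subst e_.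
have [K [G [kap [gam [d0 [d00 pK pG [kP k0] HGK]]]]]] := simple_zero_data pf p0 p1.
apply/kP; apply/eqP; apply: contraT => k1.
have [N [h [dh hE]]] : exists N (h : 'I_2 -> 'I_2 -> C -> C),
    (forall i j z, cnorm z < e -> exists l, cderiv (h i j) z l) /\
    (forall i j z, 0 < cnorm z < e -> h i j z = z ^+ N * W (x0 + z) i j).
  apply: (laurent_numerator hH) => x xe; apply: WH.
  by rewrite normE cof_gt0 lt_cof.
have /choice[a aP] : forall j, exists a, ps a (h ord0 j).
  by move=> j; apply: (holo_ps e0 (dh _ j)).
have /choice[v vP] : forall j, exists a, ps a (h ord_max j).
  by move=> j; apply: (holo_ps e0 (dh _ j)).
(* The extra shift is the additional factor z in U = z^(N+1) w_1. *)
pose u j := shiftc (a j).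
have uP j : ps (u j) (fun z => z * h ord0 j z) := ps_mulX (aP j).
have S j : rec_sys 1 kap gam N (u j) (v j).
  apply: (@fun_sys_rec _ 1 K G N (fun z => z * h ord0 j z) (h ord_max j)
    _ _ _ _ (Num.min e d0)) => //.
    by rewrite lt_min e0.
  move=> z /andP[z0]; rewrite lt_min => /andP[ze zd].
  have zn : z != 0 by rewrite -cnorm_gt0.
  have [dWx _] : is_derive (x0 + z) 1 W (sysA r 1 (x0 + z) *m W (x0 + z)) /\ W (x0 + z) \in unitmx.
    by apply: dW; rewrite normE cof_gt0 lt_cof addrAC subrr add0r z0.
  have [f2 GK] := HGK z zd.
  have Gn : G z != 0 by apply/eqP => E; move/eqP: GK; rewrite E mul0r eq_sym oner_eq0.
  have KE : K z = (G z)^-1 by rewrite -[RHS]mulr1 -GK mulKf.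
  have D0 := is_derive_entry ord0 j dWx; have D1 := is_derive_entry ord_max j dWx.
  rewrite (sysA_mul r 1 (x0 + z) _ j).1 mul1r f2 in D0.
  rewrite (sysA_mul r 1 (x0 + z) _ j).2 mul1r f2 in D1.
  (* The numerators agree with z^N W only off the centre, so the comparison takes place in a disc
     about z that avoids 0 and stays within radius e. *)
  have near (i : 'I_2) l : cderiv (fun z => z ^+ N * W (x0 + z) i j) z l -> cderiv (h i j) z l.
    apply: (@cderiv_near _ _ _ _ _ (Num.min (cnorm z) (e - cnorm z))).
      by rewrite lt_min z0 subr_gt0.
    move=> y; rewrite lt_min => /andP[y1 y2]; rewrite hE//.
    have := cnorm_subr z (z - y); rewrite cnorm_distC in y1 y2.
    have := cnormB z (z - y); rewrite subKr => q1 q2; apply/andP; split; lra.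
  have E0 := near ord0 _
    (cderivM (cderivX N z) (@cderiv_shift _ (fun x => W x ord0 j) x0 z _ D0)).
  have E1 := near ord_max _
    (cderivM (cderivX N z) (@cderiv_shift _ (fun x => W x ord_max j) x0 z _ D1)).
  do 2 eexists; split; [exact: (cderivM (cderiv_id z) E0)|exact: E1|..].
    rewrite !hE ?z0// KE.
    have -> : N%:R * z ^+ N.-1 * W (x0 + z) ord0 j = N%:R * z ^+ N / z * W (x0 + z) ord0 j.
      by case: (N) => [|n]; rewrite ?mul0r//= exprS; field.
    by rewrite -(natr1 N); field; rewrite Gn zn.
  rewrite !hE ?z0//.
  have -> : N%:R * z ^+ N.-1 * W (x0 + z) ord_max j = N%:R * z ^+ N / z * W (x0 + z) ord_max j.
    by case: (N) => [|n]; rewrite ?mul0r//= exprS; field.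
  by field; exact: zn.
pose i0 : 'I_2 := ord0; pose i1 : 'I_2 := ord_max.
(* A nontrivial combination of the columns with vanishing resonant coefficient has only zero
   coefficients by [rec_sys_vanish]. The columns are then dependent near the centre, against
   invertibility. *)
have [x [y [xy Exy]]] : exists x y : C, (x != 0) || (y != 0) /\ x * u i0 N.+1 + y * u i1 N.+1 = 0.
  have [uz|un] := eqVneq (u i0 N.+1) 0.
    by exists 1, 0; rewrite oner_eq0 uz mulr0 mul0r addr0.
  by exists (u i1 N.+1), (- u i0 N.+1); rewrite oppr_eq0 un orbT; split => //; ring.
have VAN := rec_sys_vanish (oner_neq0 _) k1 (rec_sys_lin x y (S i0) (S i1)) Exy.
have PU := eq_ps (fun n => (VAN n).1) (psD (psZ x (uP i0)) (psZ y (uP i1))).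
have PV := eq_ps (fun n => (VAN n).2) (psD (psZ x (vP i0)) (psZ y (vP i1))).
have [e1 e10 Q1] := ps_eq PU (ps_zero R); have [e2 e20 Q2] := ps_eq PV (ps_zero R).
pose t := Num.min e (Num.min e1 e2) / 2.
have mt : 0 < Num.min e (Num.min e1 e2) by rewrite !lt_min e0 e10.
have t0 : 0 < t by rewrite divr_gt0.
have tm : t < Num.min e (Num.min e1 e2) by rewrite /t; lra.
move: tm; rewrite !lt_min => /and3P[te t1 t2].
pose z := cof t : C.
have nz : cnorm z = t by rewrite cnorm_cof gtr0_norm.
have zn : z != 0 by rewrite -cnorm_gt0 nz.
have hz i j : h i j z = z ^+ N * W (x0 + z) i j by rewrite hE// nz t0.
have B1 : x * W (x0 + z) ord0 i0 + y * W (x0 + z) ord0 i1 = 0.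
  have := Q1 z; rewrite nz => /(_ t1); rewrite /= !hz => E.
  apply: (mulfI (expf_neq0 N.+1 zn)); rewrite mulr0 -[RHS]E exprS; ring.
have B2 : x * W (x0 + z) ord_max i0 + y * W (x0 + z) ord_max i1 = 0.
  have := Q2 z; rewrite nz => /(_ t2); rewrite /= !hz => E.
  apply: (mulfI (expf_neq0 N zn)); rewrite mulr0 -[RHS]E; ring.
have [_] : is_derive (x0 + z) 1 W (sysA r 1 (x0 + z) *m W (x0 + z)) /\ W (x0 + z) \in unitmx.
  by apply: dW; rewrite normE cof_gt0 lt_cof addrAC subrr add0r nz t0.
rewrite unitmx2 -/i0 -/i1 in B1 B2 *.
move: B1 B2; move: (W _ i0 i0) (W _ i0 i1) (W _ i1 i0) (W _ i1 i1) => A B D E B1 B2 /negP[].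
have Ex : x * (A * E - B * D) = 0.
  have -> : x * (A * E - B * D) = (x * A + y * B) * E - B * (x * D + y * E) by ring.
  by rewrite B1 B2; ring.
have Ey : y * (A * E - B * D) = 0.
  have -> : y * (A * E - B * D) = A * (x * D + y * E) - (x * A + y * B) * D by ring.
  by rewrite B1 B2; ring.
by case/orP: xy => q; apply/eqP; apply: (mulfI q); rewrite mulr0.
Qed.

End Necessity.

(** * The criterion in terms of second derivatives, and the passage to poles *)

Section SimpleZero.
Variable R : realType.
Local Notation C := (Cx R).

(* Exchanging the two rows of a solution of the system of r solves that of q = 1 / r. *)
Lemma strong_regular_swap (r q : C -> C) (rho x0 : C) (e : R) : 0 < e ->
  (forall x, 0 < cnorm (x - x0) < e -> r x ^+ 2 = (q x ^+ 2)^-1) ->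
  strong_regular (sysA r rho) x0 -> strong_regular (sysA q rho) x0.
Proof.
move=> e0 rq [d_ [W [d_0 [dW [m [H [hH WH]]]]]]].
have [d d0 dd] := gt0_cof d_0; subst d_.
pose sw (M : 'M[C]_2) : 'M[C]_2 := \matrix_(i, j) M (rev_ord i) j.
have r0 : rev_ord ord0 = ord_max :> 'I_2 by apply/val_inj.
have r1 : rev_ord ord_max = ord0 :> 'I_2 by apply/val_inj.
exists (cof (Num.min e d)), (fun x => sw (W x)).
split; first by rewrite cof_gt0 lt_min e0.
have sub x : `|x - x0| < cof (Num.min e d) -> `|x - x0| < cof d /\ cnorm (x - x0) < e.
  by rewrite !normE !lt_cof lt_min => /andP[].
split.
  move=> x /andP[x1 /sub [x2 x3]]; have [|dWx uW] := dW x; first by rewrite x1.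
  have xx : 0 < cnorm (x - x0) < e by move: x1; rewrite normE cof_gt0 => ->.
  have rx := rq x xx.
  have rx' : (r x ^+ 2)^-1 = q x ^+ 2 by rewrite rx invrK.
  split.
    apply: is_derive_matrix => i j.
    have := is_derive_entry (rev_ord i) j dWx.
    have -> : (sysA r rho x *m W x) (rev_ord i) j = (sysA q rho x *m sw (W x)) i j.
      elim/ord2P: i.
        by rewrite r0 (sysA_mul r rho x _ j).2 (sysA_mul q rho x _ j).1 mxE r1 rx.
      by rewrite r1 (sysA_mul r rho x _ j).1 (sysA_mul q rho x _ j).2 mxE r0 rx'.
    by apply: cderiv_near ltr01 _ => y _; rewrite mxE.
  move: uW; rewrite !unitmx2 !mxE r0 r1; apply: contra => /eqP E.
  by apply/eqP; rewrite -oppr0 -E; ring.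
exists m, (fun x => sw (H x)); split.
  move=> x /sub [x2 _]; have dH := derivableP (hH x x2).
  suff [] : is_derive x (1 : C) (fun x => sw (H x)) (sw ('D_1 H x)) by [].
  apply: is_derive_matrix => i j; rewrite mxE.
  have := is_derive_entry (rev_ord i) j dH.
  by apply: cderiv_near ltr01 _ => y _; rewrite mxE.
move=> x /andP[x1 /sub [x2 _]]; apply/matrixP => i j.
by rewrite mxE WH ?x1// !mxE.
Qed.

Lemma ps_derive1 (f : C -> C) (x0 : C) (phi : nat -> C) : ps phi (fun z => f (x0 + z)) ->
  derive1 f x0 = phi 1%N /\ derive1n 2 f x0 = 2 * phi 2%N.
Proof.
move=> pf; have [g pg [e e0 dg]] := ps_cderiv_ex pf.
have df x : cnorm (x - x0) < e -> cderiv f x (g (x - x0)).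
  move=> xe; have := cderiv_center (dg _ xe); apply: cderiv_near ltr01 _ => y _.
  by rewrite subrKC.
have D1 x : cnorm (x - x0) < e -> derive1 f x = g (x - x0) by move=> /df /cderiv_derive1.
have xx : cnorm (x0 - x0) < e by rewrite subrr cnorm0.
split; first by rewrite D1// subrr (ps_at0 pg) /derivc mul1r.
have [g' pg' [d d0 dg']] := ps_cderiv_ex pg.
have := dg' 0; rewrite cnorm0 => /(_ d0); rewrite (ps_at0 pg') -{1}(subrr x0) => /cderiv_center H.
rewrite /derivc mul1r in H.
apply: cderiv_derive1; apply: cderiv_near e0 _ H => y ye.
by rewrite [RHS]D1.
Qed.

Lemma simple_zero_regularP (f : C -> C) (x0 : C) (e : R) : 0 < e ->
  (forall x, cnorm (x - x0) < e -> derivable f x 1) -> f x0 = 0 -> derive1 f x0 != 0 ->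
  (derive1n 2 f x0 = 0 -> forall rho, strong_regular (sysA f rho) x0) /\
  (strong_regular (sysA f 1) x0 -> derive1n 2 f x0 = 0).
Proof.
move=> e0 df f0 f1.
have [phi pf] : exists phi, ps phi (fun z => f (x0 + z)).
  apply: (holo_ps e0) => z ze; exists (derive1 f (x0 + z)).
  apply: cderiv_shift; apply: derivable_cderiv; apply: df.
  by rewrite addrAC subrr add0r.
have [E1 E2] := ps_derive1 pf.
have p0 : phi 0%N = 0 by rewrite -(ps_at0 pf) addr0.
rewrite E1 in f1; rewrite E2; split => [/eqP|sr].
  rewrite mulf_eq0 pnatr_eq0 /= => /eqP p2; exact: zero_regular pf p0 f1 p2.
by rewrite (regular_zero pf p0 f1 sr) mulr0.
Qed.

End SimpleZero.

Theorem theorem6p1 (R : realType) (r : Cx R -> Cx R) (P : set (Cx R)) :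
  meromorphic r P ->
  (exists z : Cx R, ~ P z /\ r z != 0) ->
  (forall z : Cx R, zero_of r P z -> derive1 r z != 0) ->
  (forall p : Cx R, P p -> pole_of_order r p 1) ->
  ((forall (rho x0 : Cx R), zero_of r P x0 \/ P x0 ->
      strong_regular (sysA r rho) x0)
  <->
  ((forall z : Cx R, zero_of r P z -> derive1n 2 r z = 0) /\
   (forall y : Cx R, P y -> derive1n 2 (recip_ext r P) y = 0))).
Proof.
move=> [Pdisc Pder _] _ zsimple psimple.
pose q := recip_ext r P.
have zeroP z : zero_of r P z ->
  (derive1n 2 r z = 0 -> forall rho, strong_regular (sysA r rho) z) /\
  (strong_regular (sysA r 1) z -> derive1n 2 r z = 0).
  (* Any pole in the isolating disc about z would be z itself, which is not in [P]; hence r is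
     differentiable on that whole disc. *)
  move=> zz; have [nP rz] := zz; have [e_ e_0 He] := Pdisc z.
  have [e e0 ee] := gt0_cof e_0; subst e_.
  apply: (simple_zero_regularP e0) => //; last exact: zsimple.
  move=> x xe; apply: Pder => Px; apply: nP.
  by rewrite -(He x _ Px)// normE lt_cof.
have poleP y : P y -> exists2 e : R, 0 < e &
   (forall x, 0 < cnorm (x - y) < e -> q x = (r x)^-1) /\
   ((derive1n 2 q y = 0 -> forall rho, strong_regular (sysA q rho) y) /\
    (strong_regular (sysA q 1) y -> derive1n 2 q y = 0)).
  move=> Py; have [e_ e_0 He] := Pdisc y.
  have [e e0 ee] := gt0_cof e_0; subst e_.
  have [_ [h [d_ [d_0 [hh [h0 rh]]]]]] := psimple y Py.
  have [d d0 dd] := gt0_cof d_0; subst d_.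
  have qr x : 0 < cnorm (x - y) < e -> q x = (r x)^-1.
    move=> /andP[x0 xe]; rewrite /q /recip_ext; case: asboolP => // Px.
    have xy : x = y by apply: He => //; rewrite normE lt_cof.
    by move: x0; rewrite xy subrr cnorm0 ltxx.
  exists e => //; split => //.
  have dh : cderiv h y (derive1 h y).
    by apply: derivable_cderiv; apply: hh; rewrite subrr normr0.
  have [c c0 hc] : exists2 c : R, 0 < c & forall x, cnorm (x - y) < c -> h x != 0.
    have hy : 0 < cnorm (h y) by rewrite cnorm_gt0.
    have [c c0 Hc] := cderiv_cont dh (divr_gt0 hy (ltr0n R 2)).
    exists c => // x /Hc; rewrite subrKC => H; apply: contraTneq H => ->.
    by rewrite sub0r cnormN -ltNge; lra.
  (* The value 0 assigned by [recip_ext] at the pole is the one that makes this hold at y too; so q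
     is differentiable there, with q'(y) = 1 / h(y) nonzero. *)
  have qh x : cnorm (x - y) < Num.min e (Num.min d c) -> (x - y) * (h x)^-1 = q x.
    rewrite !lt_min => /and3P[xe xd xc].
    have [->|xy] := eqVneq x y.
      by rewrite subrr mul0r /q /recip_ext; case: asboolP.
    have x0 : 0 < cnorm (x - y) by rewrite cnorm_gt0 subr_eq0.
    rewrite qr ?x0// rh; last by rewrite normE cof_gt0 lt_cof x0.
    by rewrite expr1 invf_div.
  have m0 : 0 < Num.min e (Num.min d c) by rewrite !lt_min e0 d0.
  have dq x : cnorm (x - y) < Num.min e (Num.min d c) ->
      cderiv q x (1 * (h x)^-1 + (x - y) * (- derive1 h x / h x ^+ 2)).
    move=> xm; pose s := Num.min e (Num.min d c) - cnorm (x - y).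
    have s0 : 0 < s by rewrite subr_gt0.
    apply: (cderiv_near s0 (f := fun x => (x - y) * (h x)^-1)).
      move=> z zs; apply: qh; have := cnormD (z - x) (x - y); rewrite addrA subrK.
      by move=> /le_lt_trans; apply; rewrite -ltrBrDr.
    have dxy : cderiv (fun x : Cx R => x - y) x 1.
      by have := cderivB (cderiv_id x) (cderiv_cst y x); rewrite subr0.
    move: xm; rewrite !lt_min => /and3P[xe xd xc].
    apply: cderivM dxy _; apply: cderivV (hc x xc) _; apply: derivable_cderiv.
    by apply: hh; rewrite normE lt_cof.
  apply: (simple_zero_regularP m0).
  - by move=> x /dq; exact: cderiv_derivable.
  - by rewrite -qh ?subrr ?cnorm0// mul0r.
  - have := dq y; rewrite subrr cnorm0 => /(_ m0) /cderiv_derive1 ->.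
    by rewrite mul1r mul0r addr0 invr_eq0.
split=> [H|[Hz Hp] rho x0].
  split=> [z zz|y Py].
    by have [_] := zeroP z zz; apply; apply: H; left.
  have [e e0 [qr [_ Hq]]] := poleP y Py; apply: Hq.
  (* At a pole regularity is known for r but the criterion concerns q, so the swap goes from r to q;
     in the converse below it goes back. *)
  apply: (@strong_regular_swap _ r q 1 y e e0); last by apply: H; right.
  by move=> x /qr ->; rewrite exprVn invrK.
move=> [zz|Py]; first by have [+ _] := zeroP x0 zz; apply; exact: Hz.
have [e e0 [qr [Hq _]]] := poleP x0 Py.
apply: (@strong_regular_swap _ q r rho x0 e e0); last by apply: Hq; exact: Hp.
by move=> x /qr ->; rewrite exprVn.
Qed.
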